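(* Let $f \in \mathcal{M}^{-1}(L_c)$ with $c_0 > 1$. Then for all $x>0$ the following series expansions hold: $$f(x)= \sum_{n=1}^\infty \mu(n)\sum_{m=1}^\infty f(xnm),\qquad (A)$$ $$f(x)= \sum_{n=1}^\infty \sum_{m=1}^\infty \mu(m) f(xnm),\qquad (B)$$ $$f(x)=\sum_{k=0}^\infty \sum_{n=1}^\infty 2^k \mu(n)\sum_{m=1}^\infty (-1)^{m-1} f\left(xnm 2^k\right),\qquad (C)$$ $$f(x)=\sum_{n=1}^\infty (-1)^{n-1} \sum_{k=0}^\infty \sum_{m=1}^\infty 2^k \mu(m) f\left(xnm 2^k\right),\qquad (D)$$ $$f(x)- 2f(2x)= \sum_{n=1}^\infty \mu(n)\sum_{m=1}^\infty (-1)^{m-1} f(xnm).$$ Moreover, expansions (A), (B) generate the reciprocal pair of transformations $$g(x)= \frac{1}{2\pi i}\int_c \zeta(s)f^{*}(s) x^{-s}ds= \sum_{n=1}^\infty f(xn),\qquad f(x)= \frac{1}{2\pi i}\int_c \frac{g^{*}(s)}{\zeta(s)} x^{-s}ds= \sum_{n=1}^\infty \mu(n) g(xn),$$ which are automorphisms of the space $\mathcal{M}^{-1}(L_c)$ and satisfy the norm inequalities $$[\zeta(c_0)]^{-1}\, \|g\|_{\mathcal{M}^{-1}(L_c)} \le \|f\|_{\mathcal{M}^{-1}(L_c)}\le \zeta(c_0)\, \|g\|_{\mathcal{M}^{-1}(L_c)}, \quad c_0 > 1.$$ Analogously, expansions (C), (D) generate the reciprocal transformations $$g(x)= \frac{1}{2\pi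 i}\int_c (1-2^{1-s}) \zeta(s)f^{*}(s) x^{-s}ds= \sum_{n=1}^\infty (-1)^{n-1} f(xn),$$ $$f(x)= \frac{1}{2\pi i}\int_c \frac{g^{*}(s)}{(1-2^{1-s})\zeta(s)} x^{-s}ds= \sum_{k=0}^\infty\sum_{n=1}^\infty 2^k \mu(n) g\left(xn 2^k\right),$$ which are automorphisms of the space $\mathcal{M}^{-1}(L_c)$ and satisfy the norm estimates $$ [\zeta(c_0)]^{-1} \|g\|_{\mathcal{M}^{-1}(L_c)} \le \|f\|_{\mathcal{M}^{-1}(L_c)}\le (1- 2^{1-c_0})^{-1} \zeta(c_0) \|g\|_{\mathcal{M}^{-1}(L_c)}, \quad c_0 > 1.$$
   Context: Here $c=\{s\in\mathbb{C}:\operatorname{Re}s=c_0\}$ is a vertical line, $c_0\in\mathbb{R}$ fixed. $\mathcal{M}^{-1}(L_c)$ denotes the space of functions $f(x)$, $x\in\mathbb{R}_+=(0,\infty)$, representable as inverse Mellin transforms $$f(x)=\frac{1}{2\pi i}\int_c f^{*}(s)x^{-s}\,ds$$ of functions $f^{*}\in L_1(c)$ integrable on the line $c$; it is a Banach space with the norm $$\|f\|_{\mathcal{M}^{-1}(L_c)}=\frac{1}{2\pi}\int_{-\infty}^{+\infty}|f^{*}(c_0+it)|\,dt .$$ For $f,g\in\mathcal{M}^{-1}(L_c)$, $f^*$ and $g^*$ denote the corresponding (a.e. unique) functions in $L_1(c)$. $\mu$ is the M\''obius function and $\zeta$ the Riemann zeta-function. *)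

(* Defs.v *)
From HB Require Import structures.
From mathcomp Require Import all_boot all_order all_algebra.
From mathcomp Require Import complex.
From mathcomp Require Import all_classical all_reals all_analysis.
Import Order.TTheory GRing.Theory Num.Theory.
Import numFieldNormedType.Exports.

Set Implicit Arguments.
Unset Strict Implicit.
Unset Printing Implicit Defensive.

Local Open Scope classical_set_scope.
Local Open Scope ring_scope.
Local Open Scope complex_scope.

Definition mobius (n : nat) : int :=
  if (0 < n)%N && all (fun p => logn p n == 1%N) (primes n)
  then (-1) ^+ size (primes n) else 0.

Section ComplexSeries.
Variable R : realType.

(* [R[i]^o] gives [R[i]] its usual topology. *)
Definition csum_to (a : nat) (u : nat -> R[i]) (l : R[i]) : Prop :=
  (fun N => \sum_(a <= n < N) u n : R[i]^o) @ \oo --> (l : R[i]^o).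

Definition csummable (a : nat) (u : nat -> R[i]) : Prop :=
  exists l, csum_to a u l.

(* Junk value unless [csummable a u]. *)
Definition csum (a : nat) (u : nat -> R[i]) : R[i] :=
  limn (fun N => \sum_(a <= n < N) u n : R[i]^o).

Definition cexp (z : R[i]) : R[i] :=
  (expR (complex.Re z))%:C * (cos (complex.Im z) +i* sin (complex.Im z)).

(* Principal power of a positive real base. *)
Definition cpow (x : R) (s : R[i]) : R[i] := cexp (s * (ln x)%:C).

(* The Dirichlet series: this is the Riemann zeta function for Re s > 1, the
   only half-plane in which it is used. *)
Definition zeta (s : R[i]) : R[i] := csum 1 (fun n => cpow n%:R (- s)).

End ComplexSeries.

Section MellinSpace.
Variable R : realType.
Implicit Types (F : R[i] -> R[i]) (f g : R -> R[i]).

(* [L1_line c0 F]: F is in L_1 of the line Re s = c0.  Only the values of F on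
   that line matter. *)
Definition L1_line (c0 : R) F : Prop :=
  (@lebesgue_measure R).-integrable setT
     (fun t => (complex.Re (F (c0 +i* t)))%:E) /\
  (@lebesgue_measure R).-integrable setT
     (fun t => (complex.Im (F (c0 +i* t)))%:E).

(* The integral of F(s) ds along the upward line s = c0 + i t, so that
   ds = i dt. *)
Definition line_integral (c0 : R) F : R[i] :=
  'i * ((\int[@lebesgue_measure R]_t complex.Re (F (c0 +i* t))) +i*
        (\int[@lebesgue_measure R]_t complex.Im (F (c0 +i* t)))).

Definition inv_mellin (c0 : R) F (x : R) : R[i] :=
  (2 * (pi : R)%:C * 'i)^-1 * line_integral c0 (fun s => F s * cpow x (- s)).

(* Elements of the space are functions on R_+ = (0, +oo); they are represented
   by functions on R whose values outside R_+ are irrelevant. *)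
Definition eqRp f g : Prop := forall x : R, 0 < x -> f x = g x.

Definition mellin_rep (c0 : R) f F : Prop := L1_line c0 F /\ eqRp f (inv_mellin c0 F).

Definition MLspace (c0 : R) : set (R -> R[i]) := [set f | exists F, mellin_rep c0 f F].

(* The function f^* attached to f in the space: a choice among functions that
   agree almost everywhere on the line. *)
Definition mstar (c0 : R) f : R[i] -> R[i] := xget (fun=> 0) [set F | mellin_rep c0 f F].

Definition MLnorm (c0 : R) f : R :=
  (2 * pi)^-1 * \int[@lebesgue_measure R]_t Normc.normc (mstar c0 f (c0 +i* t)).

Definition mult_transform (c0 : R) (m : R[i] -> R[i]) f : R -> R[i] :=
  inv_mellin c0 (fun s => m s * mstar c0 f s).

(* Automorphism of the Banach space: a linear bijection of the space onto
   itself which is bounded together with its inverse. *)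
Definition MLautomorphism (c0 : R) (T : (R -> R[i]) -> (R -> R[i])) : Prop :=
  [/\ forall f, MLspace c0 f -> MLspace c0 (T f),
      (forall (a : R[i]) f g h, MLspace c0 f -> MLspace c0 g ->
         eqRp h (fun x => a * f x + g x) ->
         eqRp (T h) (fun x => a * T f x + T g x)),
      (forall f g, MLspace c0 f -> MLspace c0 g ->
         eqRp (T f) (T g) -> eqRp f g),
      (forall g, MLspace c0 g -> exists2 f, MLspace c0 f & eqRp (T f) g)
    & exists K : R, forall f, MLspace c0 f ->
        MLnorm c0 (T f) <= K * MLnorm c0 f /\
        MLnorm c0 f <= K * MLnorm c0 (T f)].

Definition MLreciprocal (c0 : R) (T S : (R -> R[i]) -> (R -> R[i])) : Prop :=
  (forall f, MLspace c0 f -> eqRp (S (T f)) f) /\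
  (forall g, MLspace c0 g -> eqRp (T (S g)) g).

End MellinSpace.

(* Main.v *)
Require Import Defs.
From HB Require Import structures.
From mathcomp Require Import all_boot all_order all_algebra.
From mathcomp Require Import complex.
From mathcomp Require Import all_classical all_reals all_analysis.
From mathcomp Require Import measurable_realfun.
From mathcomp Require Import ring lra zify.
Import Order.TTheory GRing.Theory Num.Theory.
Import numFieldNormedType.Exports.

Set Implicit Arguments.
Unset Strict Implicit.
Unset Printing Implicit Defensive.

Local Open Scope classical_set_scope.
Local Open Scope ring_scope.
Local Open Scope complex_scope.

(** Let [F] be integrable on the line [Re s = c0] and let [f] be its inverse Mellin
    transform. Dilating the argument of [f] by [y] multiplies [F] by [y ^ (- s)], so
    that a series of dilations of [f] should be the transform of [F] multiplied by
    a Dirichlet series. For [c0 > 1] the Dirichlet series involved converge at every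
    point of the line and their partial sums are uniformly bounded there; hence
    dominated convergence allows termwise integration ([mult_series_mellin]). Each
    expansion then is an identity between multipliers, consequence of three facts:
    the Dirichlet series of the Moebius function is the inverse of [zeta]
    ([mobius_sum]), the alternating series is [(1 - 2 ^ (1 - s)) * zeta s]
    ([eta_sum]), and the powers of [2 ^ (1 - s)], of modulus less than [1], form a
    geometric series ([csum_geometric]).

    The two transformations are multiplications of [F] by functions which are
    bounded on the line together with their inverses, and the norm estimates are
    the bounds on these functions: both [zeta] and [1 / zeta] are bounded by
    [zeta c0], since [1] and the Moebius function are bounded by [1], and
    [1 / (1 - 2 ^ (1 - s))] is bounded by the sum of a real geometric series.

    To speak of the norm, of the transform of a transform, or of linearity, one
    needs [f] to determine [F] almost everywhere. On the line, [f] gives the Fourier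
    transform of [F], so this is the injectivity of the Fourier transform on
    integrable functions ([fourier_eq0]). If all the integrals of a real integrable
    [A] against sines of any frequency and phase vanish, then so do those against
    trigonometric polynomials.
    The indicator of a ray is an almost everywhere limit of uniformly bounded
    trigonometric polynomials of growing period, so the integral of [A] over every
    ray is zero by dominated convergence, and [A] vanishes almost everywhere by
    Lebesgue differentiation. *)

(** * Complex numbers *)

Section ComplexNumbers.
Variable R : realType.
Implicit Types (z w : R[i]) (x y : R) (u v : nat -> R[i]).

Lemma cReM z w : complex.Re (z * w) =
  complex.Re z * complex.Re w - complex.Im z * complex.Im w.
Proof. by case: z w => [a b] [c d]. Qed.

Lemma cImM z w : complex.Im (z * w) =
  complex.Re z * complex.Im w + complex.Im z * complex.Re w.
Proof. by case: z w => [a b] [c d]. Qed.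

Lemma cReD z w : complex.Re (z + w) = complex.Re z + complex.Re w.
Proof. by case: z w => [a b] [c d]. Qed.

Lemma cImD z w : complex.Im (z + w) = complex.Im z + complex.Im w.
Proof. by case: z w => [a b] [c d]. Qed.

Lemma cReN z : complex.Re (- z) = - complex.Re z.
Proof. by case: z. Qed.

Lemma cImN z : complex.Im (- z) = - complex.Im z.
Proof. by case: z. Qed.

Lemma complex_ext z w :
  complex.Re z = complex.Re w -> complex.Im z = complex.Im w -> z = w.
Proof. by case: z w => [a b] [c d] /= -> ->. Qed.

Lemma normcE_sqrt z :
  Normc.normc z = Num.sqrt (complex.Re z ^+ 2 + complex.Im z ^+ 2).
Proof. by case: z. Qed.

Lemma normc_norm z : `|z| = (Normc.normc z)%:C.
Proof. by rewrite normc_def normcE_sqrt. Qed.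

Lemma normc_ge0 z : 0 <= Normc.normc z.
Proof. by rewrite normcE_sqrt sqrtr_ge0. Qed.

Lemma normcM z w : Normc.normc (z * w) = Normc.normc z * Normc.normc w.
Proof. exact: ComplexField.Normc.normcM. Qed.

Lemma normcX z n : Normc.normc (z ^+ n) = Normc.normc z ^+ n.
Proof.
elim: n => [|n IH]; first by rewrite !expr0 ComplexField.Normc.normc1.
by rewrite !exprS normcM IH.
Qed.

Lemma normcN z : Normc.normc (- z) = Normc.normc z.
Proof. by rewrite !normcE_sqrt cReN cImN !sqrrN. Qed.

Lemma ler_normcD z w : Normc.normc (z + w) <= Normc.normc z + Normc.normc w.
Proof. by rewrite -lecR rmorphD /= -!normc_norm ler_normD. Qed.

Lemma ler_normc_sum (I : Type) (r : seq I) (P : pred I) (F : I -> R[i]) :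
  Normc.normc (\sum_(i <- r | P i) F i) <= \sum_(i <- r | P i) Normc.normc (F i).
Proof.
elim/big_ind2: _ => //; first by rewrite ComplexField.Normc.normc0.
move=> a b c d h1 h2; apply: le_trans (ler_normcD _ _) _.
exact: lerD.
Qed.

Lemma normc_real x : Normc.normc x%:C = `|x|.
Proof. by rewrite normcE_sqrt /= expr0n /= addr0 sqrtr_sqr. Qed.

Lemma Re_le_normc z : `|complex.Re z| <= Normc.normc z.
Proof.
by rewrite normcE_sqrt -sqrtr_sqr ler_wsqrtr// lerDl sqr_ge0.
Qed.

Lemma Im_le_normc z : `|complex.Im z| <= Normc.normc z.
Proof.
by rewrite normcE_sqrt -sqrtr_sqr ler_wsqrtr// lerDr sqr_ge0.
Qed.

Lemma normc_le_ReIm z : Normc.normc z <= `|complex.Re z| + `|complex.Im z|.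
Proof.
rewrite normcE_sqrt -[leRHS]ger0_norm ?addr_ge0// -[leRHS]sqrtr_sqr.
rewrite ler_wsqrtr// sqrrD !real_normK ?num_real//.
by rewrite -addrA lerD2l lerDr mulrn_wge0// mulr_ge0.
Qed.

Lemma norm_squeeze (a b : nat -> R) :
  (forall n, `|a n| <= b n) -> b @ \oo --> (0 : R) -> a @ \oo --> (0 : R).
Proof.
move=> ab b0; apply: norm_cvg0.
apply: (@squeeze_cvgr _ _ _ _ (cst 0) b _ _ 0 (@cvg_cst _ _ _ _ _) b0).
by apply: nearW => n /=; rewrite normr_ge0 ab.
Qed.

Definition ccvg u (l : R[i]) := (u : nat -> R[i]^o) @ \oo --> (l : R[i]^o).

(** The topology of [R[i]] is defined through its complex-valued norm; this
    brings convergence back to real sequences. *)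
Lemma ccvg_normc u l :
  ccvg u l <-> (fun n => Normc.normc (u n - l)) @ \oo --> (0 : R).
Proof.
have E n : `|l - u n| = (Normc.normc (u n - l))%:C.
  by rewrite normc_norm -normcN opprB.
have E' n : `|0 - Normc.normc (u n - l)| = Normc.normc (u n - l).
  by rewrite sub0r normrN ger0_norm ?normc_ge0.
split=> [/cvgrPdist_lt h|/cvgrPdist_lt h]; apply/cvgrPdist_lt => e e0.
  have e0' : (0 : R[i]) < e%:C by rewrite ltcR.
  by move: (h _ e0'); apply: filterS => n; rewrite E' E ltcR.
have eE : e = (complex.Re e)%:C by rewrite RRe_real// realE (ltW e0).
rewrite eE ltcR in e0.
by move: (h _ e0); apply: filterS => n; rewrite E' E [in X in _ -> X]eE ltcR.
Qed.

Lemma ccvg_ReIm u l : ccvg u l <->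
  ((fun n => complex.Re (u n)) @ \oo --> complex.Re l /\
   (fun n => complex.Im (u n)) @ \oo --> complex.Im l).
Proof.
rewrite ccvg_normc; split=> [h|[h1 h2]].
  split; apply/subr_cvg0; refine (norm_squeeze _ h) => n.
    by rewrite -cReN -cReD Re_le_normc.
  by rewrite -cImN -cImD Im_le_normc.
move/subr_cvg0: h1 => /cvg_norm; rewrite normr0 => h1.
move/subr_cvg0: h2 => /cvg_norm; rewrite normr0 => h2.
have h : (fun n => `|complex.Re (u n) - complex.Re l| +
                   `|complex.Im (u n) - complex.Im l|) @ \oo --> (0 : R).
  by rewrite -[X in _ --> X]addr0; exact: cvgD.
refine (norm_squeeze _ h) => n.
by rewrite ger0_norm ?normc_ge0//= -cReN -cImN -cReD -cImD normc_le_ReIm.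
Qed.

Lemma ccvg_unique u l1 l2 : ccvg u l1 -> ccvg u l2 -> l1 = l2.
Proof.
move=> /ccvg_ReIm[h1 k1] /ccvg_ReIm[h2 k2].
by apply: complex_ext; [exact: cvg_unique h1 h2|exact: cvg_unique k1 k2].
Qed.

Lemma ccvg_ext u v l : u =1 v -> ccvg u l -> ccvg v l.
Proof. by move=> /funext ->. Qed.

Lemma ccvg_cst l : ccvg (fun=> l) l.
Proof. by apply/ccvg_ReIm; split; exact: cvg_cst. Qed.

Lemma ccvgD u v l1 l2 :
  ccvg u l1 -> ccvg v l2 -> ccvg (fun n => u n + v n) (l1 + l2).
Proof. exact: cvgD. Qed.

Lemma ccvgM u v l1 l2 :
  ccvg u l1 -> ccvg v l2 -> ccvg (fun n => u n * v n) (l1 * l2).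
Proof. exact: cvgM. Qed.

Lemma ccvg_limE u l : ccvg u l -> limn (u : nat -> R[i]^o) = l.
Proof. by move=> h; apply: cvg_lim => //; exact: norm_hausdorff. Qed.

Lemma ccvg_normc_le u l (K : R) :
  ccvg u l -> (forall n, Normc.normc (u n) <= K) -> Normc.normc l <= K.
Proof.
move=> /ccvg_normc h uK.
have h' : (fun n => Normc.normc (u n - l) + K) @ \oo --> K.
  by rewrite -[X in _ --> X]add0r; apply: cvgD h _; exact: cvg_cst.
rewrite -(cvg_lim _ h')//; apply: limr_ge.
  by apply/cvg_ex; exists K.
apply: nearW => n.
have lE : l = - (u n - l) + u n by rewrite opprB subrK.
by rewrite {1}lE (le_trans (ler_normcD _ _))// normcN lerD2l.
Qed.

End ComplexNumbers.

(* [ccvg] unfolds to an inclusion of filters, the binders of which would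
   otherwise be counted among the arguments of these lemmas. *)
Arguments ccvg_cst {R} l.
Arguments ccvgD {R u v l1 l2} _ _.
Arguments ccvgM {R u v l1 l2} _ _.
Arguments ccvg_ext {R u v l} _ _.
Arguments norm_squeeze {R a b} _ _.

(** * Integrals of complex-valued functions *)

Section ComplexIntegral.
Variable R : realType.
Notation mu := (@lebesgue_measure R).
Implicit Types (G H m : R -> R[i]) (K : R) (a : R[i]).

Definition cmeasurable G : Prop :=
  measurable_fun [set: R] (fun t => complex.Re (G t)) /\
  measurable_fun [set: R] (fun t => complex.Im (G t)).

Definition cintegrable G : Prop :=
  mu.-integrable setT (fun t => (complex.Re (G t))%:E) /\
  mu.-integrable setT (fun t => (complex.Im (G t))%:E).

Definition cint G : R[i] :=
  (\int[mu]_t complex.Re (G t)) +i* (\int[mu]_t complex.Im (G t)).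

Lemma cmeasurable_cst a : cmeasurable (fun=> a).
Proof. by split; exact: measurable_cst. Qed.

Lemma cmeasurableD G H :
  cmeasurable G -> cmeasurable H -> cmeasurable (fun t => G t + H t).
Proof.
move=> [g1 g2] [h1 h2]; split.
  by under eq_fun do rewrite cReD; exact: measurable_funD.
by under eq_fun do rewrite cImD; exact: measurable_funD.
Qed.

Lemma cmeasurableM G H :
  cmeasurable G -> cmeasurable H -> cmeasurable (fun t => G t * H t).
Proof.
move=> [g1 g2] [h1 h2]; split.
  under eq_fun do rewrite cReM.
  by apply: measurable_funB; exact: measurable_funM.
under eq_fun do rewrite cImM.
by apply: measurable_funD; exact: measurable_funM.
Qed.

Lemma cmeasurable_cvg (G_ : nat -> R -> R[i]) G :
  (forall n, cmeasurable (G_ n)) -> (forall t, ccvg (G_ ^~ t) (G t)) ->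
  cmeasurable G.
Proof.
move=> mG cG; split.
  apply: (@measurable_realfun.measurable_fun_cvg _ _ _ _
    (fun n t => complex.Re (G_ n t))) => [n|t _]; first exact: (mG n).1.
  by have /ccvg_ReIm[] := cG t.
apply: (@measurable_realfun.measurable_fun_cvg _ _ _ _
  (fun n t => complex.Im (G_ n t))) => [n|t _]; first exact: (mG n).2.
by have /ccvg_ReIm[] := cG t.
Qed.

Lemma cintegrable_measurable G : cintegrable G -> cmeasurable G.
Proof.
by move=> [/measurable_int/measurable_EFinP h1 /measurable_int/measurable_EFinP h2].
Qed.

(** [|Re G| + |Im G|] serves as the integrable majorant of [G]. *)
Lemma integrable_ReIm G : cintegrable G ->
  mu.-integrable setT
    (fun t => (`|complex.Re (G t)| + `|complex.Im (G t)|)%:E).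
Proof.
move=> [iR iI]; under eq_fun do rewrite EFinD.
by apply: integrableD => //; [exact: integrable_norm iR|exact: integrable_norm iI].
Qed.

Lemma cintegrable_le G H K : cmeasurable H -> cintegrable G ->
  (forall t, Normc.normc (H t) <= K * Normc.normc (G t)) -> cintegrable H.
Proof.
move=> [mR mI] iG HG.
have iK := integrableZl measurableT K (integrable_ReIm iG).
have K0 t : `|K * (`|complex.Re (G t)| + `|complex.Im (G t)|)| >= Normc.normc (H t).
  rewrite normrM [X in _ * X]ger0_norm ?addr_ge0//.
  apply: le_trans (HG t) _.
  apply: (@le_trans _ _ (`|K| * Normc.normc (G t))).
    by apply: ler_wpM2r; [exact: normc_ge0|exact: ler_norm].
  by apply: ler_wpM2l => //; exact: normc_le_ReIm.
split; apply: le_integrable iK => //.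
- exact/measurable_EFinP.
- by move=> t _; rewrite -EFinM !abse_EFin lee_fin (le_trans (Re_le_normc _)).
- exact/measurable_EFinP.
- by move=> t _; rewrite -EFinM !abse_EFin lee_fin (le_trans (Im_le_normc _)).
Qed.

Lemma cintegrableM m K G : cmeasurable m ->
  (forall t, Normc.normc (m t) <= K) -> cintegrable G ->
  cintegrable (fun t => m t * G t).
Proof.
move=> mm mK iG; apply: (cintegrable_le (K := K) _ iG).
  exact: cmeasurableM mm (cintegrable_measurable iG).
by move=> t; rewrite normcM ler_wpM2r// normc_ge0.
Qed.

Lemma cintegrableD G H :
  cintegrable G -> cintegrable H -> cintegrable (fun t => G t + H t).
Proof.
move=> [g1 g2] [h1 h2]; split.
  under eq_fun do rewrite cReD EFinD; exact: integrableD.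
under eq_fun do rewrite cImD EFinD; exact: integrableD.
Qed.

Lemma cintegrableZ a G : cintegrable G -> cintegrable (fun t => a * G t).
Proof.
exact: (cintegrableM (K := Normc.normc a) (cmeasurable_cst a)).
Qed.

Lemma cintD G H : cintegrable G -> cintegrable H ->
  cint (fun t => G t + H t) = cint G + cint H.
Proof.
move=> [g1 g2] [h1 h2]; apply: complex_ext => /=.
  rewrite -RintegralD//; apply: eq_Rintegral => t _; exact: cReD.
by rewrite -RintegralD//; apply: eq_Rintegral => t _; exact: cImD.
Qed.

Lemma RintegrableZ (k : R) (f : R -> R) :
  mu.-integrable setT (fun t => (f t)%:E) ->
  mu.-integrable setT (fun t => (k * f t)%:E).
Proof. by move=> h; under eq_fun do rewrite EFinM; exact: integrableZl. Qed.

Lemma cintZ a G : cintegrable G -> cint (fun t => a * G t) = a * cint G.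
Proof.
move=> [g1 g2]; rewrite /cint; case: a => a b; apply: complex_ext => /=.
  rewrite -!RintegralZl// -RintegralB//; try exact: RintegrableZ.
  by apply: eq_Rintegral => t _; rewrite cReM.
rewrite -!RintegralZl// -RintegralD//; try exact: RintegrableZ.
by apply: eq_Rintegral => t _; rewrite cImM.
Qed.

Lemma cintegrable_normc G : cintegrable G ->
  mu.-integrable setT (fun t => (Normc.normc (G t))%:E).
Proof.
move=> iG; apply: le_integrable (integrable_ReIm iG) => //.
  apply/measurable_EFinP; under eq_fun do rewrite normcE_sqrt.
  apply: (measurableT_comp (continuous_measurable_fun (@sqrt_continuous R))).
  have [mR mI] := cintegrable_measurable iG.
  by apply: measurable_funD; exact: measurable_funX.
move=> t _; rewrite !abse_EFin lee_fin ger0_norm ?normc_ge0//.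
by rewrite ger0_norm ?addr_ge0// normc_le_ReIm.
Qed.

Lemma aeS (P Q : R -> Prop) : (forall t, P t -> Q t) ->
  {ae mu, forall t, P t} -> {ae mu, forall t, Q t}.
Proof. by move=> PQ; apply: filterS; first exact: (ae_filter_ringOfSetsType mu). Qed.

Lemma aeI (P Q : R -> Prop) : {ae mu, forall t, P t} ->
  {ae mu, forall t, Q t} -> {ae mu, forall t, P t /\ Q t}.
Proof. by apply: filterI; exact: (ae_filter_ringOfSetsType mu). Qed.

Lemma aeT (P : R -> Prop) : (forall t, P t) -> {ae mu, forall t, P t}.
Proof. by move=> PT; apply: filterE; first exact: (ae_filter_ringOfSetsType mu). Qed.

Lemma Rintegral_ae (f g : R -> R) :
  measurable_fun setT f -> measurable_fun setT g ->
  {ae mu, forall t, f t = g t} -> \int[mu]_t f t = \int[mu]_t g t.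
Proof.
move=> mf mg fg; rewrite /Rintegral; congr fine; apply: ae_eq_integral => //.
- exact/measurable_EFinP.
- exact/measurable_EFinP.
- by apply: aeS fg => t -> _.
Qed.

Lemma cint_ae G H : cmeasurable G -> cmeasurable H ->
  {ae mu, forall t, G t = H t} -> cint G = cint H.
Proof.
move=> [? ?] [? ?] GH; rewrite /cint.
by congr Complex; apply: Rintegral_ae => //; apply: aeS GH => t ->.
Qed.

Lemma Rintegral_dominated (f_ : nat -> R -> R) (f g : R -> R) :
  (forall n, measurable_fun setT (f_ n)) -> measurable_fun setT f ->
  {ae mu, forall t, (f_ ^~ t) @ \oo --> f t} ->
  mu.-integrable setT (fun t => (g t)%:E) -> (forall n t, `|f_ n t| <= g t) ->
  (fun n => \int[mu]_t f_ n t) @ \oo --> \int[mu]_t f t.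
Proof.
move=> mf_ mf cf ig fg.
have [|||||i_ _ h] := @dominated_convergence _ _ R mu setT measurableT
  (fun n t => (f_ n t)%:E) (fun t => (f t)%:E) (fun t => (g t)%:E).
- by move=> n; exact: (measurableT_comp (@EFin_measurable R setT) (mf_ n)).
- exact/measurable_EFinP.
- apply: (aeS _ cf) => t cft _; apply: cvg_EFin => //; exact: nearW.
- exact: ig.
- by apply: aeT => t n _; rewrite lee_fin.
- apply: fine_cvg; rewrite fineK//; exact: integrable_fin_num.
Qed.

(** Dominated convergence for bounded multipliers of a fixed integrable
    function: every series expansion below is an instance of it. *)
Lemma cint_cvg (m_ : nat -> R -> R[i]) m K G :
  (forall n, cmeasurable (m_ n)) -> (forall n t, Normc.normc (m_ n t) <= K) ->
  (forall t, ccvg (m_ ^~ t) (m t)) -> cintegrable G ->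
  ccvg (fun n => cint (fun t => m_ n t * G t)) (cint (fun t => m t * G t)).
Proof.
move=> mm mK cm iG.
have mM := cmeasurable_cvg mm cm.
have iK := integrableZl measurableT K (integrable_ReIm iG).
have mG := cintegrable_measurable iG.
have dom n t : Normc.normc (m_ n t * G t) <=
    K * (`|complex.Re (G t)| + `|complex.Im (G t)|).
  rewrite normcM; apply: ler_pM; rewrite ?normc_ge0//; exact: normc_le_ReIm.
have cMG t : ccvg (fun n => m_ n t * G t) (m t * G t).
  by apply: ccvgM; [exact: cm|exact: ccvg_cst].
apply/ccvg_ReIm; split; apply: Rintegral_dominated iK _.
- by move=> n; have [] := cmeasurableM (mm n) mG.
- by have [] := cmeasurableM mM mG.
- by apply: aeT => t; have /ccvg_ReIm[] := cMG t.
- by move=> n t; exact: le_trans (Re_le_normc _) (dom n t).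
- by move=> n; have [] := cmeasurableM (mm n) mG.
- by have [] := cmeasurableM mM mG.
- by apply: aeT => t; have /ccvg_ReIm[] := cMG t.
- by move=> n t; exact: le_trans (Im_le_normc _) (dom n t).
Qed.

End ComplexIntegral.

(** * Injectivity of the Fourier transform *)

Section FourierUniqueness.
Variable R : realType.
Notation mu := (@lebesgue_measure R).
Implicit Types (A h b : R -> R).

Lemma integrable_bounded A b K : mu.-integrable setT (fun t => (A t)%:E) ->
  measurable_fun [set: R] b -> (forall t, `|b t| <= K) ->
  mu.-integrable setT (fun t => (A t * b t)%:E).
Proof.
move=> iA mb bK.
have /measurable_int/measurable_EFinP mA := iA.
apply: le_integrable (RintegrableZ K iA) => //.
- by apply/measurable_EFinP; exact: measurable_funM.
- move=> t _; rewrite !abse_EFin lee_fin !normrM mulrC ler_wpM2r//.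
  by rewrite (le_trans (bK t))// ler_norm.
Qed.

(** Asking for all the modulations of [h] makes the condition stable under
    multiplication of [h] by sines, hence by trigonometric polynomials. *)
Definition orth A h : Prop :=
  [/\ measurable_fun [set: R] h, exists K, forall t, `|h t| <= K
    & forall u v, \int[mu]_t (A t * (h t * sin (u * t + v))) = 0].

Lemma measurable_sin_affine u v : measurable_fun [set: R] (fun t => sin (u * t + v)).
Proof.
apply: (measurableT_comp (continuous_measurable_fun (@continuous_sin R))).
by apply: measurable_funD => //; exact: measurable_funM.
Qed.

Lemma orthD A h1 h2 (a1 a2 : R) : mu.-integrable setT (fun t => (A t)%:E) ->
  orth A h1 -> orth A h2 -> orth A (fun t => a1 * h1 t + a2 * h2 t).
Proof.
move=> iA [m1 [K1 b1] o1] [m2 [K2 b2] o2]; split.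
- by apply: measurable_funD; exact: measurable_funM.
- exists (`|a1| * K1 + `|a2| * K2) => t.
  by rewrite (le_trans (ler_normD _ _))// !normrM lerD// ler_wpM2l.
move=> u v.
have i1 := integrable_bounded (K := K1 * 1) iA
  (measurable_funM m1 (measurable_sin_affine u v)).
have i2 := integrable_bounded (K := K2 * 1) iA
  (measurable_funM m2 (measurable_sin_affine u v)).
have bs t : `|sin (u * t + v)| <= 1 by rewrite ler_norml sin_geN1 sin_le1.
have {}i1 := i1 (fun t => ltac:(by rewrite normrM ler_pM)).
have {}i2 := i2 (fun t => ltac:(by rewrite normrM ler_pM)).
transitivity (a1 * (\int[mu]_t (A t * (h1 t * sin (u * t + v)))) +
              a2 * (\int[mu]_t (A t * (h2 t * sin (u * t + v))))).
  rewrite -!RintegralZl// -RintegralD//; try exact: RintegrableZ.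
  by apply: eq_Rintegral => t _; ring.
by rewrite o1 o2 !mulr0 addr0.
Qed.

Lemma orth_sin A h w c : mu.-integrable setT (fun t => (A t)%:E) ->
  orth A h -> orth A (fun t => h t * sin (w * t + c)).
Proof.
move=> iA [mh [K bK] o]; split.
- by apply: measurable_funM => //; exact: measurable_sin_affine.
- exists (K * 1) => t; rewrite normrM ler_pM//.
  by rewrite ler_norml sin_geN1 sin_le1.
move=> u v.
have i u1 v1 : mu.-integrable setT (fun t => (A t * (h t * sin (u1 * t + v1)))%:E).
  apply: (integrable_bounded (K := K * 1)) => //.
    by apply: measurable_funM => //; exact: measurable_sin_affine.
  by move=> t; rewrite normrM ler_pM// ler_norml sin_geN1 sin_le1.
have i1 := i (u - w) (v - c + pi / 2); have i2 := i (u + w) (v + c + pi / 2).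
transitivity (2^-1 *
    (\int[mu]_t (A t * (h t * sin ((u - w) * t + (v - c + pi / 2))))) +
  (- 2^-1) *
    (\int[mu]_t (A t * (h t * sin ((u + w) * t + (v + c + pi / 2)))))).
  rewrite -!RintegralZl// -RintegralD//; try exact: RintegrableZ.
  apply: eq_Rintegral => t _.
  have -> : (u - w) * t + (v - c + pi / 2) =
    (u * t + v) - (w * t + c) + pi / 2 by ring.
  have -> : (u + w) * t + (v + c + pi / 2) =
    (u * t + v) + (w * t + c) + pi / 2 by ring.
  by rewrite !sinDpihalf (cosB (u * t + v)) (cosD (u * t + v)); field.
by rewrite !o !mulr0 addr0.
Qed.

Section Approximation.
Variables (A : R -> R) (iA : mu.-integrable setT (fun t => (A t)%:E)).
Hypothesis A_sin : forall u v, \int[mu]_t (A t * sin (u * t + v)) = 0.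
Variable a : R.

Let y (N : nat) (t : R) := (1 + sin ((t - a) / N.+1%:R)) / 2.

(** Trigonometric polynomials approximating the indicator of [t < a].
    The polynomials [(1 - y ^ n) ^ 2 ^ n] tend to [1] for [0 <= y < 1/2] and to
    [0] for [1/2 < y <= 1]; letting the period of [y] grow with [N] leaves the
    single transition point [t = a]. The exponent [N.+1 ^ 2] outweighs the slope
    of [y] at [a], which is of order [1 / N.+1]. *)
Let step (N : nat) (t : R) :=
  (1 - y N t ^+ (N.+1 ^ 2)) ^+ (2 ^ (N.+1 ^ 2)).

Let orth1 : orth A (fun=> 1).
Proof.
split; first exact: measurable_cst.
  by exists 1 => t; rewrite normr1.
by move=> u v; rewrite -[RHS](A_sin u v); apply: eq_Rintegral => t _; rewrite mul1r.
Qed.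

Let orth_y N h : orth A h -> orth A (fun t => h t * y N t).
Proof.
move=> oh.
have := orthD 2^-1 2^-1 iA oh (orth_sin (N.+1%:R^-1) (- a / N.+1%:R) iA oh).
congr orth; apply/funext => t; rewrite /y.
have -> : N.+1%:R^-1 * t + - a / N.+1%:R = (t - a) / N.+1%:R by ring.
by field.
Qed.

Let orth_step N : orth A (step N).
Proof.
rewrite /step; elim: (2 ^ (N.+1 ^ 2))%N => [|M IH].
  by under eq_fun do rewrite expr0; exact: orth1.
have oy k : orth A (fun t => (1 - y N t ^+ (N.+1 ^ 2)) ^+ M * y N t ^+ k).
  elim: k => [|k IHk]; first by under eq_fun do rewrite expr0 mulr1.
  by under eq_fun do rewrite exprSr mulrA; exact: orth_y.
have := orthD 1 (-1) iA IH (oy (N.+1 ^ 2)%N).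
by congr orth; apply/funext => t; rewrite exprSr; ring.
Qed.

Let bernoulli (x : R) n : 0 <= x -> 1 + n%:R * x <= (1 + x) ^+ n.
Proof.
move=> x0; elim: n => [|n IH]; first by rewrite mul0r addr0 expr0.
rewrite exprS; apply: le_trans (ler_wpM2l _ IH); last by rewrite addr_ge0.
have : 0 <= n%:R * (x * x) by rewrite mulr_ge0// mulr_ge0.
by rewrite -natr1; nra.
Qed.

Let expr_onem_le (x : R) n : 0 <= x <= 1 -> (1 - x) ^+ n <= (1 + n%:R * x)^-1.
Proof.
move=> /andP[x0 x1].
have p : 0 < 1 + n%:R * x by rewrite ltr_pwDl// mulr_ge0.
rewrite -[leRHS]mul1r ler_pdivlMr//.
apply: (@le_trans _ _ ((1 - x) ^+ n * (1 + x) ^+ n)).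
  by rewrite ler_wpM2l ?bernoulli// exprn_ge0// subr_ge0.
by rewrite -exprMn exprn_ile1//; nra.
Qed.

Let onem_expr_ge (x : R) n : 0 <= x <= 1 -> 1 - n%:R * x <= (1 - x) ^+ n.
Proof.
move=> /andP[x0 x1]; elim: n => [|n IH]; first by rewrite mul0r subr0 expr0.
rewrite exprS; have [h|h] := leP 0 (1 - n%:R * x).
  apply: le_trans (ler_wpM2l _ IH); last by rewrite subr_ge0.
  have : 0 <= n%:R * (x * x) by rewrite mulr_ge0// mulr_ge0.
  by rewrite -natr1; nra.
apply: (@le_trans _ _ 0); last by rewrite mulr_ge0 ?exprn_ge0// subr_ge0.
by rewrite -natr1; nra.
Qed.

Let y01 N t : 0 <= y N t <= 1.
Proof.
have := sin_geN1 ((t - a) / N.+1%:R); have := sin_le1 ((t - a) / N.+1%:R).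
by rewrite /y => ? ?; apply/andP; split; lra.
Qed.

Let yX01 N t n : 0 <= y N t ^+ n <= 1.
Proof.
have /andP[y0 y1] := y01 N t.
by rewrite exprn_ge0//= exprn_ile1.
Qed.

Let step01 N t : 0 <= step N t <= 1.
Proof.
have /andP[y0 y1] := yX01 N t (N.+1 ^ 2).
by rewrite /step exprn_ge0 ?subr_ge0//= exprn_ile1 ?subr_ge0// gerBl.
Qed.

Let powE N t n : (2 ^ n)%:R * y N t ^+ n = (1 + sin ((t - a) / N.+1%:R)) ^+ n.
Proof. by rewrite natrX -exprMn /y; congr (_ ^+ _); field. Qed.

(** Both rates come from Bernoulli's inequality, since
    [2 ^ n * y ^ n = (1 + s) ^ n]. *)
Let step_pos N t (s := sin ((t - a) / N.+1%:R)) : 0 <= s ->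
  `|step N t| <= (1 + (N.+1 ^ 2)%:R * s)^-1.
Proof.
move=> s0; rewrite ger0_norm; last by have /andP[] := step01 N t.
rewrite (le_trans (expr_onem_le _ (yX01 _ _ _)))// powE lef_pV2 ?posrE.
- by rewrite (le_trans (bernoulli _ s0))// lerDr.
- by rewrite ltr_pwDl// exprn_ge0// addr_ge0.
- by rewrite ltr_pwDl// mulr_ge0.
Qed.

Let step_neg N t (s := sin ((t - a) / N.+1%:R)) : s <= 0 ->
  `|step N t - 1| <= (1 + (N.+1 ^ 2)%:R * - s)^-1.
Proof.
move=> s0; rewrite distrC ger0_norm; last first.
  by rewrite subr_ge0; have /andP[] := step01 N t.
rewrite lerBlDr -lerBlDl; apply: le_trans (onem_expr_ge _ (yX01 _ _ _)).
rewrite powE lerD2l lerN2 -/s.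
have := @expr_onem_le (- s) (N.+1 ^ 2)%N; rewrite opprK; apply.
by rewrite oppr_ge0 s0/= lerNl sin_geN1.
Qed.

Let sin_ge_near0 : \forall x \near (0 : R), `|x| / 2 <= `|sin x| /\ 0 <= sin x * x.
Proof.
have [d v] := is_derive_sin (0 : R).
have {d v} : (fun x : R => x^-1 *: (sin (x *: 1 + 0) - sin 0)) @ 0^' --> (1 : R).
  by rewrite -[X in _ --> X]cos0 -v; exact: d.
move=> /cvgrPdist_lt /(_ (1 / 2) ltac:(lra)).
rewrite /dnbhs near_withinE; apply: filterS => x; have [->|x0 /(_ isT)] := eqVneq x 0.
  by move=> _; rewrite normr0 mul0r mulr0 normr_ge0.
rewrite addr0 sin0 subr0 /GRing.scale/= mulr1 ltr_distlC => /andP[h1 _].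
have xx : x^-1 * x = 1 by rewrite mulVf.
have x2 : 0 < x * x by rewrite -expr2 exprn_even_gt0.
pose q := x^-1 * sin x.
have sE : sin x = q * x by rewrite /q mulrAC xx mul1r.
have q2 : 1 / 2 < q by rewrite /q; lra.
rewrite sE; split; last by nra.
by rewrite normrM mulrC ler_wpM2r// ger0_norm; lra.
Qed.

Let step_cvg t : t != a -> (step ^~ t) @ \oo --> ((t <= a)%R%:R : R).
Proof.
move=> ta; pose u := t - a; have u0 : 0 < `|u| by rewrite normr_gt0 subr_eq0.
have cvg_c c : (fun N : nat => c * N.+1%:R^-1) @ \oo --> (0 : R).
  by rewrite -(mulr0 c); apply: cvgM; [exact: cvg_cst|exact: cvg_harmonic].
have near_bd : \forall N \near \oo, 
    `|step N t - (t <= a)%R%:R| <= 2 / `|u| * N.+1%:R^-1.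
  have : \forall N \near \oo, `|u * N.+1%:R^-1| / 2 <= `|sin (u * N.+1%:R^-1)| /\
      0 <= sin (u * N.+1%:R^-1) * (u * N.+1%:R^-1).
    exact: (cvg_c u _ sin_ge_near0).
  apply: filterS => N; rewrite -/(u / N.+1%:R) => -[h1 h2].
  have N0 : (0 : R) < N.+1%:R by [].
  have V0 : (0 : R) < N.+1%:R^-1 by rewrite invr_gt0.
  have bd : (1 + (N.+1 ^ 2)%:R * `|sin (u / N.+1%:R)|)^-1 <= 2 / `|u| * N.+1%:R^-1.
    have -> : 2 / `|u| * N.+1%:R^-1 = (N.+1%:R * `|u| / 2)^-1.
      by field; rewrite ?gt_eqF//=. 
    rewrite lef_pV2 ?posrE.
    - apply: (@le_trans _ _ ((N.+1 ^ 2)%:R * `|sin (u / N.+1%:R)|)); last by rewrite lerDr.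
      have -> : N.+1%:R * `|u| / 2 = (N.+1 ^ 2)%:R * (`|u / N.+1%:R| / 2).
        rewrite natrX expr2 normrM (ger0_norm (ltW V0)).
        by field; rewrite ?gt_eqF//=.
      by rewrite ler_wpM2l.
    - by rewrite ltr_pwDl// mulr_ge0.
    - by rewrite divr_gt0// mulr_gt0.
  apply: le_trans bd; have [ta'|ta'] := leP t a.
    have v0 : u / N.+1%:R < 0.
      by rewrite pmulr_llt0// subr_lt0 lt_neqAle ta.
    have s0 : sin (u / N.+1%:R) <= 0 by rewrite -(nmulr_lge0 _ v0).
    by rewrite (ler0_norm s0); exact: step_neg.
  have v0 : 0 < u / N.+1%:R by rewrite divr_gt0// subr_gt0.
  have s0 : 0 <= sin (u / N.+1%:R) by rewrite -(pmulr_lge0 _ v0).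
  by rewrite subr0 (ger0_norm s0); exact: step_pos.
apply/cvgrPdist_lt => e e0.
have /cvgrPdist_lt/(_ _ e0) := cvg_c (2 / `|u|).
apply: filterS2 near_bd => N h1 h2.
rewrite distrC (le_lt_trans h1)// (le_lt_trans (ler_norm _))//.
by rewrite sub0r normrN in h2.
Qed.

(** The polynomials [step N] are bounded by [1] and orthogonal to [A], and so is
    their pointwise limit. *)
Lemma integral_ray_eq0 : \int[mu]_(t in `]-oo, a]) A t = 0.
Proof.
have /measurable_int/measurable_EFinP mA := iA.
have h : (fun N => \int[mu]_t (A t * step N t)) @ \oo -->
    \int[mu]_t (A t * (t <= a)%R%:R).
  apply: (@Rintegral_dominated _ _ _ (fun t => `|A t|)).
  - by move=> N; apply: measurable_funM => //; have [] := orth_step N.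
  - apply: measurable_funM => //.
    have -> : (fun t : R => (t <= a)%R%:R : R) = \1_`]-oo, a].
      by apply/funext => t; rewrite indicE mem_setE in_itv.
    exact: measurable_indic.
  - exists [set a]; split; [exact: measurable_set1|exact: lebesgue_measure_set1|].
    move=> t /= h; apply: contrapT => /eqP ta; apply: h.
    by apply: cvgM; [exact: cvg_cst|exact: step_cvg].
  - exact: integrable_norm iA.
  - move=> N t; rewrite normrM ler_piMr// ger0_norm; have /andP[] //:= step01 N t.
have E : \int[mu]_(t in `]-oo, a]) A t = \int[mu]_t (A t * (t <= a)%R%:R).
  rewrite Rintegral_mkcond; apply: eq_Rintegral => t _.
  rewrite patchE; case: ifPn; rewrite ?mem_setE in_itv/=.
    by move=> ->; rewrite mulr1.
  by move/negbTE => ->; rewrite mulr0.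
rewrite E; apply/esym/(cvg_unique _ _ h) => //.
have -> : (fun N => \int[mu]_t (A t * step N t)) = fun=> 0; last exact: cvg_cst.
apply/funext => N; have [_ _ /(_ 0 (pi / 2))] := orth_step N  => o.
by rewrite -[RHS]o; apply: eq_Rintegral => t _; rewrite mul0r add0r sin_pihalf mulr1.
Qed.

End Approximation.

(** The primitive of [A] vanishes identically, and its derivative is [A] almost
    everywhere. *)
Lemma fourier_real_eq0 A : mu.-integrable setT (fun t => (A t)%:E) ->
  (forall u v, \int[mu]_t (A t * sin (u * t + v)) = 0) ->
  {ae mu, forall t, A t = 0}.
Proof.
move=> iA A_sin.
have iA' (x : R) : mu.-integrable `]-oo, x] (EFin \o A).
  by apply: integrableS iA.
have := @FTC1Ny R A iA' (open_integrable_locally openT iA).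
apply: aeS => t [_]; rewrite derive1E.
have -> : (fun x : R => \int[mu]_(t0 in `]-oo, x]) A t0) = cst 0.
  by apply/funext => x; exact: integral_ray_eq0.
by rewrite -derive1E derive1_cst.
Qed.

(** The cosine and sine parts at [u] and at [-u] separate the real and
    imaginary parts of [G], so that the real case applies to each of them. *)
Lemma fourier_eq0 (G : R -> R[i]) : cintegrable G ->
  (forall u, cint (fun t => G t * (cos (u * t) +i* sin (u * t))) = 0) ->
  {ae mu, forall t, G t = 0}.
Proof.
move=> [iR iI] G0.
have b (f : R -> R) (u : R) : mu.-integrable setT (fun t => (f t)%:E) ->
  mu.-integrable setT (fun t => (f t * sin (u * t))%:E) /\
  mu.-integrable setT (fun t => (f t * cos (u * t))%:E).
  move=> i; split; apply: (integrable_bounded (K := 1)) => //.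
  - by have := measurable_sin_affine u 0; under eq_fun do rewrite addr0.
  - by move=> t; rewrite ler_norml sin_geN1 sin_le1.
  - have := measurable_sin_affine u (pi / 2).
    by under eq_fun do rewrite sinDpihalf.
  - by move=> t; rewrite ler_norml cos_geN1 cos_le1.
pose Rs u := \int[mu]_t (complex.Re (G t) * sin (u * t)).
pose Rc u := \int[mu]_t (complex.Re (G t) * cos (u * t)).
pose Is u := \int[mu]_t (complex.Im (G t) * sin (u * t)).
pose Ic u := \int[mu]_t (complex.Im (G t) * cos (u * t)).
have E1 u : Rc u - Is u = 0.
  have := congr1 (@complex.Re R) (G0 u); rewrite /= => {1}<-.
  rewrite -RintegralB//; try by have [] := b _ u iR; have [] := b _ u iI.
  by apply: eq_Rintegral => t _; rewrite cReM.
have E2 u : Rs u + Ic u = 0.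
  have := congr1 (@complex.Im R) (G0 u); rewrite /= => {1}<-.
  rewrite -RintegralD//; try by have [] := b _ u iR; have [] := b _ u iI.
  by apply: eq_Rintegral => t _; rewrite cImM.
have RintN (f : R -> R) : mu.-integrable setT (fun t => (f t)%:E) ->
    \int[mu]_t (- f t) = - \int[mu]_t f t.
  by move=> i; rewrite -mulN1r -RintegralZl//; apply: eq_Rintegral => t _; rewrite mulN1r.
have RsN u : Rs (- u) = - Rs u.
  rewrite /Rs -RintN; last by have [] := b _ u iR.
  by apply: eq_Rintegral => t _; rewrite mulNr sinN mulrN.
have IsN u : Is (- u) = - Is u.
  rewrite /Is -RintN; last by have [] := b _ u iI.
  by apply: eq_Rintegral => t _; rewrite mulNr sinN mulrN.
have RcN u : Rc (- u) = Rc u.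
  by apply: eq_Rintegral => t _; rewrite mulNr cosN.
have IcN u : Ic (- u) = Ic u.
  by apply: eq_Rintegral => t _; rewrite mulNr cosN.
have Z u : [/\ Rc u = 0, Is u = 0, Rs u = 0 & Ic u = 0].
  have := E1 u; have := E1 (- u); have := E2 u; have := E2 (- u).
  by rewrite RsN IsN RcN IcN => ? ? ? ?; split; lra.
have S (f : R -> R) : mu.-integrable setT (fun t => (f t)%:E) ->
    (forall u, \int[mu]_t (f t * sin (u * t)) = 0) ->
    (forall u, \int[mu]_t (f t * cos (u * t)) = 0) ->
    {ae mu, forall t, f t = 0}.
  move=> i fs fc; apply: fourier_real_eq0 => // u v.
  transitivity (cos v * (\int[mu]_t (f t * sin (u * t))) +
                sin v * (\int[mu]_t (f t * cos (u * t)))).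
    have [i1 i2] := b _ u i.
    rewrite -!RintegralZl// -RintegralD//; try exact: RintegrableZ.
    by apply: eq_Rintegral => t _; rewrite sinD; ring.
  by rewrite fs fc !mulr0 addr0.
have R0 : {ae mu, forall t, complex.Re (G t) = 0}.
  by apply: S => // u; have [] := Z u.
have I0 : {ae mu, forall t, complex.Im (G t) = 0}.
  by apply: S => // u; have [] := Z u.
by have := aeI R0 I0; apply: aeS => t [h1 h2]; exact: complex_ext.
Qed.

End FourierUniqueness.

(** * The Moebius function *)

Section Moebius.
Implicit Types (k n p d e : nat).

Lemma normr_mobius_le1 n : `|mobius n| <= 1.
Proof.
by rewrite /mobius; case: ifP => _; rewrite ?normr0// normrX normrN1 expr1n.
Qed.

Lemma mobius_primeM p e : prime p -> (0 < e)%N -> ~~ (p %| e)%N ->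
  mobius (p * e) = - mobius e.
Proof.
move=> pp e0 pe; have p0 := prime_gt0 pp.
have pNe : p \notin primes e by rewrite mem_primes pp e0.
have perm : perm_eq (primes (p * e)) (p :: primes e).
  apply: uniq_perm; rewrite ?primes_uniq//= ?pNe ?primes_uniq// => q.
  by rewrite primesM// primes_prime// !inE.
rewrite /mobius muln_gt0 p0 e0 /= (perm_all _ perm) (perm_size perm) /=.
have -> : (logn p (p * e) == 1)%N.
  by rewrite lognM// logn_prime// eqxx (lognE p e) (negbTE pe) !andbF addn0.
rewrite /= (@eq_in_all _ _ (fun q => logn q e == 1)%N).
  by case: ifP => _; rewrite ?oppr0// exprS mulN1r.
move=> q qe; rewrite lognM// logn_prime//.
by have [qp|] := eqVneq q p; [rewrite qp (negbTE pNe) in qe|].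
Qed.

Lemma mobius_primeM_dvd p e : prime p -> (0 < e)%N -> (p %| e)%N ->
  mobius (p * e) = 0.
Proof.
move=> pp e0 pe; have p0 := prime_gt0 pp.
rewrite /mobius; case: ifP => // /andP[_ /allP /(_ p)].
rewrite primesM// primes_prime// inE eqxx => /(_ isT).
by rewrite lognM// logn_prime// eqxx (lognE p e) pp e0 pe.
Qed.

(** For a prime [p] dividing [k], the divisors [d] prime to [p] cancel against
    their multiples [p * d]; those divisible by [p ^ 2] contribute nothing. *)
Lemma sum_mobius_divisors k : (0 < k)%N ->
  \sum_(d <- divisors k) mobius d = (k == 1)%N%:R.
Proof.
move=> k0; have [->|k1] := eqVneq k 1%N.
  by rewrite (_ : divisors 1 = [:: 1%N])// big_seq1.
have {}k1 : (1 < k)%N by rewrite ltn_neqAle eq_sym k1.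
have pp := pdiv_prime k1; have pk := pdiv_dvd k.
move: (pdiv k) pp pk => p pp pk; have p0 := prime_gt0 pp.
rewrite (bigID (fun d => p %| d)%N) /= (bigID (fun d => p %| d %/ p)%N) /=.
rewrite [X in X + _ + _]big1_seq ?add0r; last first.
  move=> d /andP[/andP[pd pdp]]; rewrite -dvdn_divisors// => dk.
  have dE : d = (p * (d %/ p))%N by rewrite mulnC divnK.
  rewrite dE mobius_primeM_dvd// divn_gt0// dvdn_leq//.
  exact: dvdn_gt0 dk.
have perm : perm_eq [seq (p * e)%N | e <- divisors k & ~~ (p %| e)%N]
    [seq d <- divisors k | (p %| d)%N && ~~ (p %| d %/ p)%N].
  apply: uniq_perm; rewrite ?filter_uniq ?divisors_uniq//.
    rewrite map_inj_uniq ?filter_uniq ?divisors_uniq//.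
    by move=> i j /eqP; rewrite eqn_pmul2l// => /eqP.
  move=> d; rewrite mem_filter -dvdn_divisors//; apply/mapP/idP.
    move=> [e]; rewrite mem_filter -dvdn_divisors// => /andP[pe ek] ->.
    rewrite dvdn_mulr// mulKn// pe /= Gauss_dvd ?pk//.
    by rewrite prime_coprime.
  move=> /andP[/andP[pd pdp] dk]; exists (d %/ p)%N; last by rewrite mulnC divnK.
  by rewrite mem_filter pdp -dvdn_divisors// (dvdn_trans _ dk)// dvdn_div.
rewrite -big_filter -(perm_big _ perm) big_map big_filter /=.
rewrite -big_split /= big_seq_cond big1// => e /andP[].
rewrite -dvdn_divisors// => ek pe.
by rewrite mobius_primeM ?addNr// (dvdn_gt0 k0 ek).
Qed.

Lemma sum_mobius_dvd N k : (0 < k < N)%N ->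
  \sum_(1 <= m < N | (m %| k)%N) mobius m = (k == 1)%N%:R.
Proof.
move=> /andP[k0 kN]; rewrite -sum_mobius_divisors// -big_filter.
apply: perm_big; apply: uniq_perm.
- by rewrite filter_uniq// iota_uniq.
- exact: divisors_uniq.
move=> m; rewrite mem_filter -dvdn_divisors// mem_index_iota.
apply: andb_idr => mk; rewrite (dvdn_gt0 k0 mk)/=.
exact: leq_ltn_trans (dvdn_leq k0 mk) kN.
Qed.

End Moebius.

(** * Complex powers and absolutely convergent series *)

Section ComplexPower.
Variable R : realType.
Implicit Types (z w s : R[i]) (x y c : R).

Lemma cexpD z w : cexp (z + w) = cexp z * cexp w.
Proof.
rewrite /cexp cReD cImD expRD rmorphM /= cosD sinD mulrACA; congr (_ * _).
by apply: complex_ext; rewrite /= addrC.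
Qed.

Lemma cexp0 : cexp (0 : R[i]) = 1.
Proof. by rewrite /cexp /= expR0 cos0 sin0 mul1r. Qed.

Lemma normc_cexp z : Normc.normc (cexp z) = expR (complex.Re z).
Proof.
rewrite /cexp normcM normc_real ger0_norm ?expR_ge0// normcE_sqrt /=.
by rewrite cos2Dsin2 sqrtr1 mulr1.
Qed.

Lemma cexp_real x : cexp x%:C = (expR x)%:C.
Proof. by rewrite /cexp /= cos0 sin0 mulr1. Qed.

Lemma cpowM x y s : 0 < x -> 0 < y -> cpow (x * y) s = cpow x s * cpow y s.
Proof. by move=> x0 y0; rewrite /cpow -cexpD lnM// rmorphD mulrDr. Qed.

Lemma cpowD x s z : cpow x (s + z) = cpow x s * cpow x z.
Proof. by rewrite /cpow -cexpD mulrDl. Qed.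

Lemma cpow1x s : cpow 1 s = 1.
Proof. by rewrite /cpow ln1 mulr0 cexp0. Qed.

Lemma cpowx1 x : 0 < x -> cpow x 1 = x%:C.
Proof. by move=> x0; rewrite /cpow mul1r cexp_real lnK. Qed.

Lemma normc_cpow x s : Normc.normc (cpow x s) = expR (complex.Re s * ln x).
Proof. by rewrite /cpow normc_cexp cReM /= mulr0 subr0. Qed.

Lemma cpow_real x c : cpow x c%:C = (expR (c * ln x))%:C.
Proof. by rewrite /cpow -rmorphM cexp_real. Qed.

Lemma cpowX x s k : 0 < x -> cpow (x ^+ k) s = cpow x s ^+ k.
Proof.
move=> x0; elim: k => [|k IH]; first by rewrite !expr0 cpow1x.
by rewrite !exprS cpowM ?exprn_gt0// IH.
Qed.

Lemma cpow2_1B s : cpow 2 (1 - s) = 2 * cpow (2 : R) (- s).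
Proof. by rewrite cpowD cpowx1// rmorph_nat. Qed.

End ComplexPower.

Section Series.
Variable R : realType.
Implicit Types (a : nat) (u v : nat -> R[i]) (l : R[i]).

Lemma sum_nat_from (V : zmodType) a N (u : nat -> V) :
  \sum_(a <= n < N) u n = \sum_(0 <= n < N) (if (a <= n)%N then u n else 0).
Proof.
rewrite big_geq_mkord big_mkcond.
by rewrite -(big_mkord xpredT (fun n => if (a <= n)%N then u n else 0)).
Qed.

Lemma csum_toE a u l : csum_to a u l -> csum a u = l.
Proof. exact: ccvg_limE. Qed.

Lemma csummable_to a u : csummable a u -> csum_to a u (csum a u).
Proof. by move=> [l h]; rewrite (csum_toE h). Qed.

Lemma csum_to_ext a u v l :
  (forall n, (a <= n)%N -> u n = v n) -> csum_to a u l -> csum_to a v l.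
Proof.
move=> uv; apply: ccvg_ext => N; apply: eq_big_nat => n /andP[an _]; exact: uv.
Qed.

Lemma cvg_subseq (phi : nat -> nat) : (forall K, (K <= phi K)%N) ->
  phi @ \oo --> \oo.
Proof.
move=> h P [N _ NP]; exists N => // K /= NK; apply: NP => /=.
exact: leq_trans NK (h K).
Qed.

Lemma csummable_normc a u (K : R) :
  (forall N, \sum_(a <= n < N) Normc.normc (u n) <= K) -> csummable a u.
Proof.
move=> uK.
pose w n := if (a <= n)%N then u n else 0.
have wK N : \sum_(0 <= n < N) Normc.normc (w n) <= K.
  apply: le_trans (uK N); rewrite [leRHS]sum_nat_from; apply: ler_sum => n _.
  by rewrite /w; case: ifP => //; rewrite ComplexField.Normc.normc0.
have cv (f : R[i] -> R) : (forall z, `|f z| <= Normc.normc z) ->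
    cvgn (series (fun n => f (w n))).
  move=> fn; apply: normed_cvg; apply: nondecreasing_is_cvgn.
    apply/nondecreasing_seqP => n; rewrite /normed_series_of /= seriesSr/=.
    by rewrite lerDl.
  exists K => _ [N _ <-]; apply: le_trans (wK N).
  by rewrite /normed_series_of /series /=; apply: ler_sum => n _; exact: fn.
have /cvg_ex[lr hr] := cv _ (@Re_le_normc R).
have /cvg_ex[li hi] := cv _ (@Im_le_normc R).
exists (lr +i* li); apply/ccvg_ReIm; split => /=.
  apply: cvg_trans hr; apply: near_eq_cvg; apply: nearW => N.
  by rewrite sum_nat_from /series/= (big_morph _ (@cReD R) (erefl _)).
apply: cvg_trans hi; apply: near_eq_cvg; apply: nearW => N.
by rewrite sum_nat_from /series/= (big_morph _ (@cImD R) (erefl _)).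
Qed.

Lemma csumMl a u l (b : R[i]) :
  csum_to a u l -> csum_to a (fun n => b * u n) (b * l).
Proof.
move=> h; apply: (ccvg_ext (u := fun N => b * \sum_(a <= n < N) u n)).
  by move=> N; rewrite mulr_sumr.
exact (ccvgM (ccvg_cst b) h).
Qed.

Lemma csum_geometric (w : R[i]) : Normc.normc w < 1 ->
  csum_to 0 (fun k => w ^+ k) (1 - w)^-1.
Proof.
move=> w1.
have w1' : 1 - w != 0.
  apply/eqP => /eqP; rewrite subr_eq0 => /eqP h.
  by move: w1; rewrite -h ComplexField.Normc.normc1 ltxx.
have E N : \sum_(0 <= k < N) w ^+ k = (1 - w)^-1 * (1 + - (w ^+ N)).
  elim: N => [|N IH]; first by rewrite big_geq// expr0 subrr mulr0.
  by rewrite big_nat_recr//= IH exprS; field.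
apply: (ccvg_ext (u := fun N => (1 - w)^-1 * (1 + - (w ^+ N)))) => [N|].
  by rewrite E.
rewrite -[X in ccvg _ X]mulr1; apply: ccvgM; first exact: ccvg_cst.
rewrite -[X in ccvg _ X]addr0; apply: ccvgD; first exact: ccvg_cst.
apply/ccvg_normc; have h := @cvg_expr R (Normc.normc w).
rewrite ger0_norm ?normc_ge0// in h.
refine (norm_squeeze _ (h w1)) => N.
by rewrite subr0 normcN normcX ger0_norm// exprn_ge0// normc_ge0.
Qed.

End Series.

(** * Dirichlet series in the half-plane of absolute convergence *)

Section RealZeta.
Variables (R : realType) (c : R).
Hypothesis c1 : 1 < c.

(** [n ^ (- c)], the absolute value of [n ^ (- s)] on the line [Re s = c]. *)
Definition npow (n : nat) : R := expR (- c * ln n%:R).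

Let c0 : 0 < c. Proof. exact: lt_trans c1. Qed.

Lemma npow_ge0 n : 0 <= npow n. Proof. exact: expR_ge0. Qed.

Lemma npow1 : npow 1 = 1.
Proof. by rewrite /npow ln1 mulr0 expR0. Qed.

Lemma npowM n m : (0 < n)%N -> (0 < m)%N -> npow (n * m) = npow n * npow m.
Proof.
by move=> n0 m0; rewrite /npow natrM lnM ?posrE ?ltr0n// mulrDr expRD.
Qed.

Lemma npow_le n m : (0 < n <= m)%N -> npow m <= npow n.
Proof.
move=> /andP[n0 nm]; rewrite /npow ler_expR !mulNr lerN2 ler_pM2l//.
by rewrite ler_ln ?posrE ?ltr0n ?ler_nat// (leq_trans n0).
Qed.

Lemma npow2_lt1 : 2 * npow 2 < 1.
Proof.
have E : expR (ln 2) = 2 :> R by rewrite lnK// posrE.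
rewrite /npow -[X in X * _]E -expRD -[ltRHS]expR0 ltr_expR.
by rewrite mulNr subr_lt0 ltr_pMl// ln_gt0// ltr1n.
Qed.

Definition npow_bound : R := (1 - 2 * npow 2)^-1.

(** Splitting the integers below [2 N + 2] by parity gives
    [S (2 N + 2) <= 1 + 2 ^ (1 - c) * S (N + 1)] for the partial sums [S]. *)
Lemma sum_npow_le N : \sum_(1 <= n < N) npow n <= npow_bound.
Proof.
have T M : \sum_(1 <= n < M.*2.+2) npow n <=
    1 + 2 * npow 2 * \sum_(1 <= n < M.+1) npow n.
  elim: M => [|M IH]; first by rewrite big_nat1 npow1 big_geq// mulr0 addr0.
  rewrite doubleS big_nat_recr// big_nat_recr//= [in leRHS]big_nat_recr//=.
  have h1 : npow M.*2.+2 = npow 2 * npow M.+1 by rewrite -doubleS -mul2n npowM.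
  have h2 : npow M.*2.+3 <= npow 2 * npow M.+1 by rewrite -h1 npow_le//=.
  by rewrite mulrDr; move: IH; rewrite h1; lra.
have q0 := npow2_lt1.
rewrite /npow_bound -[leRHS]mul1r ler_pdivlMr; last by rewrite subr_gt0.
apply: (@le_trans _ _ ((\sum_(1 <= n < N.+1) npow n) * (1 - 2 * npow 2))).
  apply: ler_wpM2r; first by rewrite subr_ge0 ltW.
  case: N => [|N]; first by rewrite [leLHS]big_geq// sumr_ge0// => n _; exact: npow_ge0.
  by rewrite [leRHS]big_nat_recr//= lerDl npow_ge0.
have : \sum_(1 <= n < N.+1) npow n <= \sum_(1 <= n < N.*2.+2) npow n.
  rewrite (@big_cat_nat _ _ _ N.+1 1 N.*2.+2)//=; last first.
    by rewrite -addnn; lia.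
  by rewrite lerDl sumr_ge0// => n _; exact: npow_ge0.
by move=> h; have := le_trans h (T N); lra.
Qed.

Lemma npow_sum_cvg : cvgn (fun N => \sum_(1 <= n < N) npow n).
Proof.
apply: nondecreasing_is_cvgn; last first.
  by exists (npow_bound) => _ [N _ <-]; exact: sum_npow_le.
apply/nondecreasing_seqP => -[|n]; last by rewrite [leRHS]big_nat_recr//= lerDl npow_ge0.
by rewrite [leLHS]big_geq// sumr_ge0// => n _; exact: npow_ge0.
Qed.

Definition zeta_real : R := limn (fun N => \sum_(1 <= n < N) npow n).

Lemma npow_sum_le_zeta N : \sum_(1 <= n < N) npow n <= zeta_real.
Proof.
apply: nondecreasing_cvgn_le; last exact: npow_sum_cvg.
apply/nondecreasing_seqP => -[|n]; last by rewrite [leRHS]big_nat_recr//= lerDl npow_ge0.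
by rewrite [leLHS]big_geq// sumr_ge0// => n _; exact: npow_ge0.
Qed.

Lemma zeta_real_gt0 : 0 < zeta_real.
Proof.
apply: lt_le_trans ltr01 _; have := npow_sum_le_zeta 2.
by rewrite big_nat1 npow1.
Qed.

End RealZeta.

Section DirichletSeries.
Variables (R : realType) (s : R[i]).
Let c := complex.Re s.
Hypothesis s1 : 1 < c.
Notation zpow n := (cpow (n%:R : R) (- s)).

Lemma normc_zpow n : Normc.normc (zpow n) = npow c n.
Proof. by rewrite normc_cpow cReN. Qed.

Lemma zpowM n m : (0 < n)%N -> (0 < m)%N -> zpow (n * m) = zpow n * zpow m.
Proof. by move=> n0 m0; rewrite natrM cpowM ?ltr0n. Qed.

Lemma zpow1 : zpow 1 = 1. Proof. exact: cpow1x. Qed.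

Lemma dirichlet_partial_le (b : nat -> R[i]) N :
  (forall n, Normc.normc (b n) <= 1) ->
  \sum_(1 <= n < N) Normc.normc (b n * zpow n) <= \sum_(1 <= n < N) npow c n.
Proof.
move=> b1; apply: ler_sum => n _.
by rewrite normcM normc_zpow ler_piMl ?npow_ge0.
Qed.

Lemma dirichlet_summable (b : nat -> R[i]) :
  (forall n, Normc.normc (b n) <= 1) -> csummable 1 (fun n => b n * zpow n).
Proof.
move=> b1; apply: (@csummable_normc _ _ _ (npow_bound c)) => N.
exact: le_trans (dirichlet_partial_le N b1) (sum_npow_le s1 N).
Qed.

Lemma zeta_sum : csum_to 1 (fun n => zpow n) (zeta s).
Proof.
apply: csummable_to; have := @dirichlet_summable (fun=> 1).
move=> [|l h]; first by move=> n; rewrite ComplexField.Normc.normc1.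
by exists l; apply: csum_to_ext h => n _; rewrite mul1r.
Qed.

(** Expanding [A_N * B_N] with [A_N], [B_N] the partial sums of the Dirichlet
    series of [1] and of the Moebius function: the pairs [(n, m)] with
    [n * m < N] contribute exactly the term [1]. *)
Lemma zeta_mobius_partial N : (1 < N)%N ->
  \sum_(1 <= m < N) \sum_(1 <= n < N | (n * m < N)%N)
    (mobius m)%:~R * zpow (n * m) = 1.
Proof.
move=> N1.
transitivity (\sum_(1 <= k < N) zpow k *
    (\sum_(1 <= m < N | (m %| k)%N) mobius m)%:~R); last first.
  transitivity (\sum_(1 <= k < N) zpow k * ((k == 1)%N%:R)).
    apply: eq_big_nat => k kN; rewrite sum_mobius_dvd//.
    by case: (k == 1)%N.
  rewrite big_ltn// eqxx mulr1 zpow1 big1_seq ?addr0// => k.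
  by rewrite mem_index_iota => /andP[_ /andP[k1 _]]; rewrite gtn_eqF ?mulr0.
transitivity (\sum_(1 <= m < N) \sum_(1 <= k < N | (m %| k)%N)
    (mobius m)%:~R * zpow k); last first.
  rewrite (exchange_big_dep xpredT)//=; apply: eq_bigr => k _.
  rewrite rmorph_sum /= mulr_sumr.
  by apply: eq_big => [m|m _]; rewrite ?andbT// mulrC.
apply: eq_big_nat => m /andP[m0 mN].
rewrite -big_filter -[RHS]big_filter.
pose F k : R[i] := (mobius m)%:~R * zpow k.
rewrite -(@big_map _ _ _ _ _ (fun n => n * m)%N _ xpredT F).
apply: perm_big; apply: uniq_perm.
- rewrite map_inj_uniq ?filter_uniq ?iota_uniq// => i j /eqP.
  by rewrite eqn_pmul2r// => /eqP.
- by rewrite filter_uniq ?iota_uniq.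
move=> k; rewrite mem_filter mem_index_iota; apply/mapP/idP.
  move=> [n]; rewrite mem_filter mem_index_iota => /andP[nmN /andP[n0 nN]] ->.
  by rewrite dvdn_mull//= muln_gt0 n0 m0.
move=> /andP[/dvdnP[n kE] /andP[k0 kN]]; exists n => //.
rewrite mem_filter -kE kN mem_index_iota /=; move: k0; rewrite kE muln_gt0.
move=> /andP[-> _] /=; apply: leq_ltn_trans kN; rewrite kE leq_pmulr//.
Qed.

Lemma mobius_le1 n : Normc.normc ((mobius n)%:~R : R[i]) <= 1.
Proof.
rewrite -(rmorph_int (real_complex R)) normc_real -intr_norm.
by have := normr_mobius_le1 n; rewrite -(ler_int R).
Qed.

(** If [n * m >= K * K], then [n >= K] or [m >= K]: the remaining pairs are
    controlled by a tail of the series of [n ^ (- c)]. *)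
Lemma zeta_mobius_error K : (1 < K)%N ->
  Normc.normc ((\sum_(1 <= n < K * K) zpow n) *
    (\sum_(1 <= m < K * K) (mobius m)%:~R * zpow m) - 1) <=
  2 * npow_bound c * (\sum_(1 <= n < K * K) npow c n - \sum_(1 <= n < K) npow c n).
Proof.
move=> K1; set N := (K * K)%N.
have KN : (K <= N)%N by rewrite leq_pmulr// ltnW.
have N1 : (1 < N)%N by exact: leq_trans K1 KN.
pose D := \sum_(K <= n < N) npow c n.
have -> : \sum_(1 <= n < N) npow c n - \sum_(1 <= n < K) npow c n = D.
  by rewrite (@big_cat_nat _ _ _ K 1 N)//= 1?ltnW// addrAC subrr add0r.
have -> : (\sum_(1 <= n < N) zpow n) *
    (\sum_(1 <= m < N) (mobius m)%:~R * zpow m) - 1 =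
  \sum_(1 <= m < N) \sum_(1 <= n < N | ~~ (n * m < N)%N)
    (mobius m)%:~R * zpow (n * m).
  rewrite -[X in _ - X](zeta_mobius_partial N1) mulrC big_distrl /= -sumrB.
  apply: eq_big_nat => m /andP[m0 _]; rewrite mulr_sumr.
  rewrite (bigID (fun n => n * m < N)%N) /=.
  have E (Q : nat -> bool) : \sum_(1 <= n < N | Q n)
      (mobius m)%:~R * zpow m * zpow n =
      \sum_(1 <= n < N | Q n) (mobius m)%:~R * zpow (n * m).
    rewrite big_nat_cond [RHS]big_nat_cond.
    by apply: eq_bigr => n /andP[/andP[n0 _] _]; rewrite zpowM// -mulrA [zpow m * _]mulrC.
  by rewrite !E addrAC subrr add0r.
apply: le_trans (ler_normc_sum _ _ _) _.
have S1 : \sum_(1 <= n < N) npow c n <= npow_bound c := sum_npow_le s1 N.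
pose chi n : R := (K <= n)%N%:R.
have DE : D = \sum_(1 <= n < N) chi n * npow c n.
  rewrite (@big_cat_nat _ _ _ K 1 N)//= 1?ltnW// big_nat big1 ?add0r.
    by apply: eq_big_nat => n /andP[Kn _]; rewrite /chi Kn mul1r.
  by move=> n /andP[_ nK]; rewrite /chi leqNgt nK mul0r.
have D0 : 0 <= D by apply: sumr_ge0 => n _; exact: npow_ge0.
apply: (@le_trans _ _ (\sum_(1 <= m < N) \sum_(1 <= n < N)
   ((chi n * npow c n) * npow c m + npow c n * (chi m * npow c m)))).
  rewrite big_nat_cond [leRHS]big_nat_cond.
  apply: ler_sum => m /andP[/andP[m0 _] _].
  apply: le_trans (ler_normc_sum _ _ _) _.
  rewrite big_mkcond big_nat_cond [leRHS]big_nat_cond.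
  apply: ler_sum => n /andP[/andP[n0 _] _].
  have p0 : 0 <= npow c n * npow c m by rewrite mulr_ge0 ?npow_ge0.
  have r0 : 0 <= (chi n * npow c n) * npow c m + npow c n * (chi m * npow c m).
    by rewrite addr_ge0// !mulr_ge0 ?npow_ge0// ler0n.
  case: ifPn => // nm.
  have -> : chi n * npow c n * npow c m + npow c n * (chi m * npow c m) =
    (chi n + chi m) * (npow c n * npow c m) by ring.
  rewrite normcM normc_zpow npowM//.
  apply: (@le_trans _ _ (1 * (npow c n * npow c m))).
    by rewrite ler_wpM2r// mobius_le1.
  rewrite ler_wpM2r// /chi -natrD ler1n addn_gt0 !lt0b.
  by rewrite -implyNb -ltnNge; apply/implyP => nK; rewrite leqNgt;
    apply: contra nm => mK; exact: ltn_mul.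
have -> : \sum_(1 <= m < N) \sum_(1 <= n < N)
   ((chi n * npow c n) * npow c m + npow c n * (chi m * npow c m)) =
   2 * (D * \sum_(1 <= m < N) npow c m).
  under eq_bigr do rewrite big_split /= -!mulr_suml.
  rewrite big_split /= -!mulr_sumr -DE; ring.
by rewrite -mulrA ler_wpM2l// mulrC ler_wpM2r.
Qed.

(** The product of the partial sums tends to [zeta s * l], and to [1] along the
    squares. *)
Lemma zeta_mobius_mul (l : R[i]) :
  csum_to 1 (fun n => (mobius n)%:~R * zpow n) l -> zeta s * l = 1.
Proof.
move=> hl; pose phi K := (K.+2 * K.+2)%N.
have phi_ge K : (K <= phi K)%N by rewrite /phi; lia.
have /cvg_ex[S hS] := npow_sum_cvg s1.
have hphi : (fun K => \sum_(1 <= n < phi K) npow c n) @ \oo --> S.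
  exact: cvg_comp (cvg_subseq phi_ge) hS.
have hS2 : (fun K => \sum_(1 <= n < K.+2) npow c n) @ \oo --> S.
  by apply: cvg_comp hS; apply: cvg_subseq => K; lia.
have hd : (fun K => 2 * npow_bound c *
    (\sum_(1 <= n < phi K) npow c n - \sum_(1 <= n < K.+2) npow c n)) @ \oo --> (0 : R).
  have E0 : 0 = 2 * npow_bound c * (S - S) :> R by rewrite subrr mulr0.
  rewrite [X in _ --> X]E0.
  by apply: cvgM; [exact: cvg_cst|exact: cvgB].
have h1 : ccvg (fun K => (\sum_(1 <= n < phi K) zpow n) *
    (\sum_(1 <= m < phi K) (mobius m)%:~R * zpow m)) 1.
  apply/ccvg_normc; refine (norm_squeeze _ hd) => K.
  by rewrite ger0_norm ?normc_ge0// zeta_mobius_error.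
have h2 : ccvg (fun K => (\sum_(1 <= n < phi K) zpow n) *
    (\sum_(1 <= m < phi K) (mobius m)%:~R * zpow m)) (zeta s * l).
  have h := ccvgM zeta_sum hl.
  exact: cvg_comp (cvg_subseq phi_ge) h.
exact: ccvg_unique h2 h1.
Qed.

Lemma zeta_neq0 : zeta s != 0.
Proof.
have [l hl] := dirichlet_summable mobius_le1.
apply/eqP => z0; have := zeta_mobius_mul hl.
by rewrite z0 mul0r => /esym/eqP; rewrite oner_eq0.
Qed.

Lemma mobius_sum : csum_to 1 (fun n => (mobius n)%:~R * zpow n) (zeta s)^-1.
Proof.
have [l hl] := dirichlet_summable mobius_le1.
have lE : l = (zeta s)^-1.
  by rewrite -[RHS]mulr1 -(zeta_mobius_mul hl) mulKf// zeta_neq0.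
by rewrite -lE.
Qed.

Lemma dirichlet_le (b : nat -> R[i]) l : (forall n, Normc.normc (b n) <= 1) ->
  csum_to 1 (fun n => b n * zpow n) l -> Normc.normc l <= zeta_real c.
Proof.
move=> b1 h; apply: (ccvg_normc_le h) => N.
apply: le_trans (ler_normc_sum _ _ _) _.
exact: le_trans (dirichlet_partial_le N b1) (npow_sum_le_zeta s1 N).
Qed.

Notation w := (cpow (2 : R) (1 - s)).

Lemma normc_ratio : Normc.normc w = 2 * npow c 2.
Proof.
rewrite cpow2_1B normcM -(normc_zpow 2).
by rewrite -[2 in LHS](rmorph_nat (real_complex R)) normc_real ger0_norm.
Qed.

Lemma normc_ratio_lt1 : Normc.normc w < 1.
Proof. by rewrite normc_ratio; exact: npow2_lt1. Qed.

Lemma ratio_neq1 : 1 - w != 0.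
Proof.
apply/eqP => /eqP; rewrite subr_eq0 => /eqP h; have := normc_ratio_lt1.
by rewrite -h ComplexField.Normc.normc1 ltxx.
Qed.

Lemma normc_inv_ratio_le : Normc.normc (1 - w)^-1 <= (1 - 2 * npow c 2)^-1.
Proof.
rewrite ComplexField.Normc.normcV lef_pV2 ?posrE.
- rewrite -normc_ratio lerBlDr -[leLHS](@ComplexField.Normc.normc1 R).
  by rewrite -{1}[1](subrK w) ler_normcD.
- rewrite lt_neqAle normc_ge0 andbT eq_sym; apply/eqP.
  move=> h; have /eqP := @Normc.eq0_normc R _ h.
  by apply/negP; exact: ratio_neq1.
- by rewrite subr_gt0 npow2_lt1.
Qed.

Lemma normc_sign n : Normc.normc ((-1) ^+ n : R[i]) = 1.
Proof. by rewrite normcX normcN ComplexField.Normc.normc1 expr1n. Qed.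

(** The alternating series is the full one minus twice its even terms. *)
Lemma eta_sum :
  csum_to 1 (fun n => (-1) ^+ n.-1 * zpow n) ((1 - w) * zeta s).
Proof.
have [n|l hl] := @dirichlet_summable (fun n => (-1) ^+ n.-1).
  by rewrite normc_sign.
suff -> : (1 - w) * zeta s = l by [].
have E N : \sum_(1 <= n < N.*2.+1) (-1) ^+ n.-1 * zpow n =
    \sum_(1 <= n < N.*2.+1) zpow n + - w * \sum_(1 <= n < N.+1) zpow n.
  elim: N => [|N IH]; first by rewrite !big_geq// mulr0 addr0.
  rewrite doubleS !(@big_nat_recr _ _ _ N.*2.+2 1)//= !(@big_nat_recr _ _ _ N.*2.+1 1)//= IH.
  rewrite (@big_nat_recr _ _ _ N.+1 1)//= exprS -signr_odd odd_double expr0.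
  have -> : N.*2.+2 = (2 * N.+1)%N by lia.
  by rewrite zpowM// cpow2_1B; ring.
have hz := zeta_sum.
have i1 : (fun N => N.*2.+1) @ \oo --> \oo by apply: cvg_subseq => K; lia.
have i2 : (fun N => N.+1) @ \oo --> \oo by apply: cvg_subseq => K; lia.
have h1 : ccvg (fun N => \sum_(1 <= n < N.*2.+1) (-1) ^+ n.-1 * zpow n) l.
  exact: cvg_comp i1 hl.
have h2 : ccvg (fun N => \sum_(1 <= n < N.*2.+1) zpow n) (zeta s).
  exact: cvg_comp i1 hz.
have h3 : ccvg (fun N => \sum_(1 <= n < N.+1) zpow n) (zeta s).
  exact: cvg_comp i2 hz.
have h4 := ccvgD h2 (ccvgM (ccvg_cst (- w)) h3).
rewrite mulrBl mul1r -mulNr; apply: ccvg_unique h4 _.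
by apply: ccvg_ext h1 => N; rewrite E.
Qed.

End DirichletSeries.

Lemma zeta_realE (R : realType) (c : R) : 1 < c -> zeta c%:C = (zeta_real c)%:C.
Proof.
move=> c1; have h := @zeta_sum R c%:C c1; apply: ccvg_unique h _.
have E N : \sum_(1 <= n < N) cpow (n%:R : R) (- c%:C) =
    (\sum_(1 <= n < N) npow c n)%:C.
  rewrite rmorph_sum; apply: eq_bigr => n _ /=.
  by rewrite -rmorphN cpow_real.
apply: (ccvg_ext (fun N => esym (E N))); apply/ccvg_ReIm; split => /=.
  exact: npow_sum_cvg c1.
exact: cvg_cst.
Qed.

Lemma ratio_realE (R : realType) (c : R) :
  (1 - cpow (2 : R) (1 - c%:C))^-1 = ((1 - 2 * npow c 2)^-1)%:C.
Proof.
by rewrite cpow2_1B -rmorphN cpow_real fmorphV rmorphB rmorphM rmorph_nat rmorph1.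
Qed.

(** * The space of inverse Mellin transforms *)

Section MellinSpaceTheory.
Variables (R : realType) (c0 : R).
Notation mu := (@lebesgue_measure R).
Notation line := (fun t : R => c0 +i* t).
Implicit Types (F G : R[i] -> R[i]) (f g : R -> R[i]) (m p : R[i] -> R[i]).

(** The factor ['i] of [ds] cancels the one of [2 * pi * 'i]. *)
Lemma inv_mellinE F x : inv_mellin c0 F x =
  (2 * pi)^-1%:C * cint (fun t => F (c0 +i* t) * cpow x (- (c0 +i* t))).
Proof.
rewrite /inv_mellin /line_integral -/(cint _) mulrA; congr (_ * _).
have i0 : ('i : R[i]) != 0 by rewrite eq_complex /= oner_eq0 andbF.
by rewrite invfM -mulrA mulVf// mulr1 fmorphV rmorphM rmorph_nat.
Qed.

Lemma inv_mellin_ext F G : (forall t, F (c0 +i* t) = G (c0 +i* t)) ->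
  inv_mellin c0 F = inv_mellin c0 G.
Proof.
by move=> FG; apply/funext => x; rewrite !inv_mellinE; congr (_ * cint _);
  apply/funext => t; rewrite FG.
Qed.

Lemma inv_mellin0 F x :
  (forall t, F (c0 +i* t) = 0) -> inv_mellin c0 F x = 0.
Proof.
move=> F0; rewrite inv_mellinE /cint.
under eq_Rintegral do rewrite F0 mul0r /=.
under [X in _ +i* X]eq_Rintegral do rewrite F0 mul0r /=.
by rewrite /Rintegral integral0 mulr0.
Qed.

Lemma cpow_line x t : cpow x (- (c0 +i* t)) =
  (expR (- c0 * ln x))%:C * (cos (- ln x * t) +i* sin (- ln x * t)).
Proof.
rewrite /cpow /cexp cReM cImM cReN cImN /= !mulr0 subr0 add0r.
by rewrite !mulNr (mulrC t).
Qed.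

Definition bounded_mult (K : R) m : Prop :=
  cmeasurable (fun t => m (c0 +i* t)) /\
  forall t, Normc.normc (m (c0 +i* t)) <= K.

Lemma bounded_mult_ge0 K m : bounded_mult K m -> 0 <= K.
Proof. by move=> [_ /(_ 0)]; apply: le_trans; exact: normc_ge0. Qed.

Lemma bounded_multM K L m p : bounded_mult K m -> bounded_mult L p ->
  bounded_mult (K * L) (fun s => m s * p s).
Proof.
move=> [m1 m2] [p1 p2]; split; first exact: cmeasurableM.
by move=> t; rewrite normcM ler_pM ?normc_ge0.
Qed.

Lemma bounded_mult_cst a : bounded_mult (Normc.normc a) (fun=> a).
Proof. by split => //; exact: cmeasurable_cst. Qed.

Lemma bounded_mult_cpow x :
  bounded_mult (expR (- c0 * ln x)) (fun s => cpow x (- s)).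
Proof.
split; last by move=> t; rewrite normc_cpow cReN.
under [fun t => _]eq_fun do rewrite cpow_line.
apply: cmeasurableM; first exact: cmeasurable_cst.
have h (k : R) : measurable_fun [set: R] (fun t : R => k * t).
  by apply: measurable_funM => //; exact: measurable_cst.
split => /=.
  exact: (measurableT_comp (continuous_measurable_fun (@continuous_cos R)) (h _)).
exact: (measurableT_comp (continuous_measurable_fun (@continuous_sin R)) (h _)).
Qed.

Lemma L1_lineM K m F : bounded_mult K m -> L1_line c0 F ->
  L1_line c0 (fun s => m s * F s).
Proof. by move=> [m1 m2] iF; exact: (cintegrableM m1 m2 iF). Qed.

Lemma inv_mellinZD a F G x : L1_line c0 F -> L1_line c0 G ->
  inv_mellin c0 (fun s => a * F s + G s) x =
  a * inv_mellin c0 F x + inv_mellin c0 G x.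
Proof.
move=> iF iG; have [c1 c2] := bounded_mult_cpow x.
have iF' := cintegrableM c1 c2 iF; have iG' := cintegrableM c1 c2 iG.
rewrite !inv_mellinE mulrCA -mulrDr; congr (_ * _).
under eq_fun do rewrite mulrDl -mulrA ![_ * cpow _ _]mulrC.
rewrite cintD//; last exact: cintegrableZ.
rewrite cintZ//; congr (_ * cint _ + cint _); by apply/funext => t; rewrite mulrC.
Qed.

Lemma inv_mellinZ a F x : L1_line c0 F ->
  inv_mellin c0 (fun s => a * F s) x = a * inv_mellin c0 F x.
Proof.
move=> iF; have [c1 c2] := bounded_mult_cpow x.
have iF' := cintegrableM c1 c2 iF; rewrite !inv_mellinE mulrCA; congr (_ * _).
rewrite -cintZ; first by congr cint; apply/funext => t; rewrite mulrA.
by under eq_fun do rewrite mulrC.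
Qed.

(** Dilating the argument by [y] multiplies the integrand by [y ^ (- s)]. *)
Lemma inv_mellin_scale F x y : 0 < x -> 0 < y ->
  inv_mellin c0 F (x * y) = inv_mellin c0 (fun s => cpow y (- s) * F s) x.
Proof.
move=> x0 y0; rewrite !inv_mellinE; congr (_ * cint _); apply/funext => t.
by rewrite cpowM//; ring.
Qed.

Lemma inv_mellin_ae F G x : L1_line c0 F -> L1_line c0 G ->
  {ae mu, forall t, F (c0 +i* t) = G (c0 +i* t)} ->
  inv_mellin c0 F x = inv_mellin c0 G x.
Proof.
move=> iF iG FG; have [c1 _] := bounded_mult_cpow x.
rewrite !inv_mellinE; congr (_ * _); apply: cint_ae.
- exact: cmeasurableM (cintegrable_measurable iF) c1.
- exact: cmeasurableM (cintegrable_measurable iG) c1.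
- by apply: aeS FG => t ->.
Qed.

Lemma inv_mellin_cvg (m_ : nat -> R[i] -> R[i]) m K F x :
  (forall n, bounded_mult K (m_ n)) ->
  (forall t, ccvg (fun n => m_ n (c0 +i* t)) (m (c0 +i* t))) -> L1_line c0 F ->
  ccvg (fun n => inv_mellin c0 (fun s => m_ n s * F s) x)
       (inv_mellin c0 (fun s => m s * F s) x).
Proof.
move=> mK cm iF; have [c1 c2] := bounded_mult_cpow x.
have iF' := cintegrableM c1 c2 iF.
have E p : inv_mellin c0 (fun s => p s * F s) x = (2 * pi)^-1%:C *
    cint (fun t => p (c0 +i* t) * (cpow x (- (c0 +i* t)) * F (c0 +i* t))).
  rewrite inv_mellinE; congr (_ * cint _); apply/funext => t.
  by rewrite -mulrA [F _ * _]mulrC.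
apply: (ccvg_ext (fun n => esym (E (m_ n)))); rewrite E.
apply: ccvgM (ccvg_cst _) _.
apply: (cint_cvg (K := K)) => //.
- by move=> n; have [] := mK n.
- by move=> n t; have [_ ->] := mK n.
Qed.

(** The transform is the Fourier transform of [F] along the line, up to a
    nonzero factor depending on [x], so that it determines [F] there. *)
Lemma mellin_rep_unique f F G : mellin_rep c0 f F -> mellin_rep c0 f G ->
  {ae mu, forall t, F (c0 +i* t) = G (c0 +i* t)}.
Proof.
move=> [iF fF] [iG fG].
pose H t := F (c0 +i* t) + -1 * G (c0 +i* t).
have iH : cintegrable H by apply: cintegrableD => //; exact: cintegrableZ.
suff : {ae mu, forall t, H t = 0}.
  by apply: aeS => t /eqP; rewrite /H mulN1r subr_eq0 => /eqP.
apply: fourier_eq0 => // u; pose x := expR (- u).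
have x0 : 0 < x by exact: expR_gt0.
have h : inv_mellin c0 (fun s => -1 * G s + F s) x = 0.
  by rewrite inv_mellinZD// -fF// -fG// mulN1r addNr.
move: h; rewrite inv_mellinE => /eqP; rewrite mulf_eq0 => /orP[/eqP|/eqP h].
  move/complexI/eqP; rewrite invr_eq0 mulf_eq0 pnatr_eq0 /=.
  by rewrite gt_eqF ?pi_gt0.
have k0 : (expR (- c0 * ln x))%:C != 0 :> R[i].
  by apply/eqP => /complexI/eqP; rewrite gt_eqF ?expR_gt0.
have [c1 c2] := bounded_mult_cpow x.
have iP : cintegrable (fun t => cpow x (- (c0 +i* t)) * H t).
  exact: (cintegrableM c1 c2 iH).
have -> : (fun t => H t * (cos (u * t) +i* sin (u * t))) =
    (fun t => (expR (- c0 * ln x))%:C^-1 * (cpow x (- (c0 +i* t)) * H t)).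
  by apply/funext => t; rewrite cpow_line -mulrA mulKf// /x expRK opprK mulrC.
rewrite cintZ//; apply/eqP; rewrite mulf_eq0; apply/orP; right; apply/eqP.
rewrite -[RHS]h; congr cint; apply/funext => t.
by rewrite /H [RHS]mulrC [X in _ * X]addrC.
Qed.

End MellinSpaceTheory.

Arguments inv_mellin_cvg {R c0 m_ m K F} x _ _ _.

(** * Expansions in series of dilations *)

Section MultiplierSeries.
Variables (R : realType) (c0 : R).
Implicit Types (F : R[i] -> R[i]) (m P : R[i] -> R[i]) (p : nat -> R[i] -> R[i]).

(** The uniform bound on the partial sums is what dominated convergence asks for
    in order to integrate the series termwise against any integrable [F]. *)
Definition mult_series (a : nat) p P : Prop :=
  [/\ forall n, (a <= n)%N -> exists K, bounded_mult c0 K (p n),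
      exists K, forall N t,
        Normc.normc (\sum_(a <= n < N) p n (c0 +i* t)) <= K
    & forall t, csum_to a (fun n => p n (c0 +i* t)) (P (c0 +i* t))].

Lemma mult_series_partial a p P K : mult_series a p P ->
  (forall N t, Normc.normc (\sum_(a <= n < N) p n (c0 +i* t)) <= K) ->
  forall N, bounded_mult c0 K (fun s => \sum_(a <= n < N) p n s).
Proof.
move=> [bp _ _] h N; split=> // {h}; elim: N => [|N IH].
  under [fun t => _]eq_fun do rewrite big_geq//; exact: cmeasurable_cst.
have [aN|Na] := leqP a N; last first.
  under [fun t => _]eq_fun do rewrite big_geq//; exact: cmeasurable_cst.
under [fun t => _]eq_fun do rewrite big_nat_recr//=.
by apply: cmeasurableD => //; have [L []] := bp N aN.
Qed.

Lemma mult_series_bounded a p P K : mult_series a p P ->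
  (forall t, Normc.normc (P (c0 +i* t)) <= K) -> bounded_mult c0 K P.
Proof.
move=> h PK; split=> //; have [_ [L pL] cp] := h.
apply: (cmeasurable_cvg (G_ := fun N t => \sum_(a <= n < N) p n (c0 +i* t))).
  by move=> N; have [] := mult_series_partial h pL N.
exact: cp.
Qed.

Lemma mult_seriesM a p P m K : bounded_mult c0 K m -> mult_series a p P ->
  mult_series a (fun n s => m s * p n s) (fun s => m s * P s).
Proof.
move=> bm [bp [L pL] cp]; split.
- move=> n an; have [L' b'] := bp n an; exists (K * L'); exact: bounded_multM.
- exists (K * L) => N t; rewrite -mulr_sumr normcM.
  by have [_ mK] := bm; rewrite ler_pM ?normc_ge0.
- move=> t; exact: csumMl.
Qed.

(** All the series of the theorem are summed by this lemma: their terms are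
    transforms of one and the same [F] multiplied by the terms [p n]. *)
Lemma mult_series_mellin a p P F (u : nat -> R[i]) x :
  mult_series a p P -> L1_line c0 F ->
  (forall n, (a <= n)%N -> u n = inv_mellin c0 (fun s => p n s * F s) x) ->
  csum_to a u (inv_mellin c0 (fun s => P s * F s) x).
Proof.
move=> h iF uE; have [bp [L pL] cp] := h.
have hN := mult_series_partial h pL.
have H := inv_mellin_cvg x hN cp iF.
apply: ccvg_ext H => N.
have E0 M : (M <= a)%N -> inv_mellin c0 (fun s => (\sum_(a <= n < M) p n s) * F s) x = 0.
  by move=> Ma; apply: inv_mellin0 => t; rewrite big_geq// mul0r.
elim: N => [|N IH]; first by rewrite big_geq// E0.
have [aN|Na] := leqP a N; last by rewrite big_geq// E0.
rewrite [RHS]big_nat_recr//= -IH uE//.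
have [L' bL'] := bp N aN.
rewrite -[X in _ = X + _]mul1r -inv_mellinZD.
- rewrite (@inv_mellin_ext _ _ _
    (fun s => 1 * ((\sum_(a <= n < N) p n s) * F s) + p N s * F s))// => t.
  by rewrite big_nat_recr//= mul1r mulrDl.
- exact: L1_lineM (hN N) iF.
- exact: L1_lineM bL' iF.
Qed.

End MultiplierSeries.

Section BasicSeries.
Variables (R : realType) (c0 : R).
Hypothesis hc0 : 1 < c0.
Notation eta := (fun s : R[i] => (1 - cpow (2 : R) (1 - s)) * zeta s).
Notation mu := (fun n : nat => (mobius n)%:~R : R[i]).
Notation zpow n := (fun s : R[i] => cpow (n%:R : R) (- s)).
Notation ratio := (fun s : R[i] => cpow (2 : R) (1 - s)).

Lemma dirichlet_mult_series (b : nat -> R[i]) P :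
  (forall n, Normc.normc (b n) <= 1) ->
  (forall t, csum_to 1 (fun n => b n * zpow n (c0 +i* t)) (P (c0 +i* t))) ->
  mult_series c0 1 (fun n s => b n * zpow n s) P.
Proof.
move=> b1 cP; split => //.
- move=> n _; exists (Normc.normc (b n) * expR (- c0 * ln n%:R)).
  exact: bounded_multM (bounded_mult_cst _ _) (bounded_mult_cpow _ _).
- exists (npow_bound c0) => N t; apply: le_trans (ler_normc_sum _ _ _) _.
  have h := @dirichlet_partial_le R (c0 +i* t) b N b1.
  exact: le_trans h (sum_npow_le hc0 N).
Qed.

Lemma zeta_mult_series : mult_series c0 1 (fun n s => zpow n s) (@zeta R).
Proof.
have n1 : Normc.normc (1 : R[i]) <= 1 by rewrite ComplexField.Normc.normc1.
have := @dirichlet_mult_series (fun=> 1) (@zeta R) (fun=> n1) _.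
under [fun n s => 1 * _]eq_fun do under eq_fun do rewrite mul1r.
apply => t; under eq_fun do rewrite mul1r.
exact: (@zeta_sum R (c0 +i* t)).
Qed.

Lemma mobius_mult_series :
  mult_series c0 1 (fun n s => mu n * zpow n s) (fun s => (zeta s)^-1).
Proof.
apply: dirichlet_mult_series => [n|t]; first exact: mobius_le1.
exact: (@mobius_sum R (c0 +i* t)).
Qed.

Lemma eta_mult_series :
  mult_series c0 1 (fun n s => (-1) ^+ n.-1 * zpow n s) eta.
Proof.
apply: dirichlet_mult_series => [n|t]; first by rewrite normc_sign.
exact: (@eta_sum R (c0 +i* t)).
Qed.

Lemma bounded_mult_ratio : bounded_mult c0 (2 * npow c0 2) ratio.
Proof.
split; last by move=> t; rewrite (@normc_ratio R (c0 +i* t)).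
have [h _] := bounded_multM (bounded_mult_cst c0 2) (bounded_mult_cpow c0 2).
by under [fun t => _]eq_fun do rewrite cpow2_1B.
Qed.

Lemma bounded_multX K m k :
  bounded_mult c0 K m -> bounded_mult c0 (K ^+ k) (fun s => m s ^+ k).
Proof.
move=> h; elim: k => [|k IH].
  split; first exact: cmeasurable_cst.
  by move=> t; rewrite !expr0 ComplexField.Normc.normc1.
rewrite exprS; under [fun s => _]eq_fun do rewrite exprS.
exact: bounded_multM.
Qed.

Lemma ratio_mult_series :
  mult_series c0 0 (fun k s => ratio s ^+ k) (fun s => (1 - ratio s)^-1).
Proof.
split.
- by move=> k _; exists ((2 * npow c0 2) ^+ k); exact: bounded_multX bounded_mult_ratio.
- exists ((1 - 2 * npow c0 2)^-1) => N t.
  apply: le_trans (ler_normc_sum _ _ _) _.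
  under eq_bigr do rewrite normcX (@normc_ratio R (c0 +i* t)).
  set q := 2 * npow c0 2.
  have q1 : q < 1 by exact: npow2_lt1.
  have q0 : 0 <= q by rewrite mulr_ge0 ?npow_ge0.
  rewrite -[leRHS]mul1r ler_pdivlMr ?subr_gt0//.
  have -> : (\sum_(0 <= k < N) q ^+ k) * (1 - q) = 1 - q ^+ N.
    elim: N => [|N IH]; first by rewrite big_geq// mul0r expr0 subrr.
    by rewrite big_nat_recr//= mulrDl IH exprS; ring.
  by rewrite gerBl exprn_ge0.
- move=> t; apply: csum_geometric; exact: (@normc_ratio_lt1 R (c0 +i* t)).
Qed.

Lemma zeta_bounded : bounded_mult c0 (zeta_real c0) (@zeta R).
Proof.
apply: (mult_series_bounded zeta_mult_series) => t.
apply: (@dirichlet_le R (c0 +i* t) hc0 (fun=> 1)).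
  by move=> n; rewrite ComplexField.Normc.normc1.
under eq_fun do rewrite mul1r; exact: (@zeta_sum R (c0 +i* t)).
Qed.

Lemma zetaV_bounded : bounded_mult c0 (zeta_real c0) (fun s => (zeta s)^-1).
Proof.
apply: (mult_series_bounded mobius_mult_series) => t.
apply: (@dirichlet_le R (c0 +i* t) hc0 (fun n => mu n)).
  exact: mobius_le1.
exact: (@mobius_sum R (c0 +i* t)).
Qed.

Lemma eta_bounded : bounded_mult c0 (zeta_real c0) eta.
Proof.
apply: (mult_series_bounded eta_mult_series) => t.
apply: (@dirichlet_le R (c0 +i* t) hc0 (fun n => (-1) ^+ n.-1)).
  by move=> n; rewrite normc_sign.
exact: (@eta_sum R (c0 +i* t)).
Qed.

Lemma ratioV_bounded :
  bounded_mult c0 (1 - 2 * npow c0 2)^-1 (fun s => (1 - ratio s)^-1).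
Proof.
apply: (mult_series_bounded ratio_mult_series) => t.
exact: (@normc_inv_ratio_le R (c0 +i* t)).
Qed.

Lemma etaV_bounded :
  bounded_mult c0 ((1 - 2 * npow c0 2)^-1 * zeta_real c0) (fun s => (eta s)^-1).
Proof.
have := bounded_multM ratioV_bounded zetaV_bounded.
by under [fun s => _ * _]eq_fun do rewrite -invfM.
Qed.

Lemma zeta_line_neq0 t : zeta (c0 +i* t) != 0.
Proof. exact: (@zeta_neq0 R (c0 +i* t)). Qed.

Lemma ratio_line_neq1 t : 1 - ratio (c0 +i* t) != 0.
Proof. exact: (@ratio_neq1 R (c0 +i* t)). Qed.

Lemma eta_line_neq0 t : eta (c0 +i* t) != 0.
Proof. by rewrite mulf_neq0 ?ratio_line_neq1 ?zeta_line_neq0. Qed.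

End BasicSeries.

(** * Multiplier transformations *)

Section MultiplierTransform.
Variables (R : realType) (c0 : R).
Notation lmu := (@lebesgue_measure R).
Implicit Types (F G m : R[i] -> R[i]) (f g : R -> R[i]) (K L : R).

Lemma mstarP f : MLspace c0 f -> mellin_rep c0 f (mstar c0 f).
Proof. by move=> [F hF]; exact: (@xgetI _ _ [set F | mellin_rep c0 f F] F). Qed.

Lemma mellin_rep_eq f g F : eqRp f g -> mellin_rep c0 f F -> mellin_rep c0 g F.
Proof. by move=> fg [iF fF]; split=> // x x0; rewrite -fg// fF. Qed.

Lemma mstar_ae f F : mellin_rep c0 f F ->
  {ae lmu, forall t, mstar c0 f (c0 +i* t) = F (c0 +i* t)}.
Proof. by move=> hF; exact: (mellin_rep_unique (mstarP (ex_intro _ F hF)) hF). Qed.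

Lemma inv_mellin_mstar f x : MLspace c0 f -> 0 < x ->
  inv_mellin c0 (fun s => 1 * mstar c0 f s) x = f x.
Proof.
move=> hf x0; have [_ fF] := mstarP hf.
by rewrite fF// (@inv_mellin_ext _ _ _ (mstar c0 f))// => t; rewrite mul1r.
Qed.

Lemma MLnorm_rep f F : mellin_rep c0 f F ->
  MLnorm c0 f = (2 * pi)^-1 * \int[lmu]_t Normc.normc (F (c0 +i* t)).
Proof.
move=> hF; have [iF _] := hF; have [iS _] := mstarP (ex_intro _ F hF).
rewrite /MLnorm; congr (_ * _); apply: Rintegral_ae.
- by have /measurable_int/measurable_EFinP := cintegrable_normc iS.
- by have /measurable_int/measurable_EFinP := cintegrable_normc iF.
- by apply: aeS (mstar_ae hF) => t ->.
Qed.

Lemma MLnorm_ge0 f : 0 <= MLnorm c0 f.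
Proof.
rewrite /MLnorm mulr_ge0// ?invr_ge0 ?mulr_ge0 ?pi_ge0//.
by apply: Rintegral_ge0 => t _; exact: normc_ge0.
Qed.

Section OneMultiplier.
Variables (m : R[i] -> R[i]) (K : R).
Hypothesis bm : bounded_mult c0 K m.
Notation T := (mult_transform c0 m).

Lemma mult_transform_rep f : MLspace c0 f ->
  mellin_rep c0 (T f) (fun s => m s * mstar c0 f s).
Proof.
move=> /mstarP[iF _]; split; first exact: L1_lineM bm iF.
by move=> x _.
Qed.

Lemma mult_transform_space f : MLspace c0 f -> MLspace c0 (T f).
Proof. by move=> hf; exists (fun s => m s * mstar c0 f s); exact: mult_transform_rep. Qed.

(** The transformation may be computed from any representative of [f], since it
    is almost everywhere equal to the chosen one. *)
Lemma mult_transformE f F x : mellin_rep c0 f F ->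
  T f x = inv_mellin c0 (fun s => m s * F s) x.
Proof.
move=> hF; have [iF _] := hF; have [iS _] := mstarP (ex_intro _ F hF).
apply: inv_mellin_ae; [exact: L1_lineM bm iS|exact: L1_lineM bm iF|].
by apply: aeS (mstar_ae hF) => t ->.
Qed.

Lemma mult_transform_eq f g : MLspace c0 f -> eqRp f g -> T f =1 T g.
Proof.
move=> [F hF] fg x; rewrite (mult_transformE x hF).
by rewrite (mult_transformE x (mellin_rep_eq fg hF)).
Qed.

Lemma mult_transform_norm f : MLspace c0 f -> MLnorm c0 (T f) <= K * MLnorm c0 f.
Proof.
move=> hf; have [iF _] := mstarP hf; have hT := mult_transform_rep hf.
have [iT _] := hT.
rewrite (MLnorm_rep hT) /MLnorm mulrCA ler_wpM2l//.
  by rewrite invr_ge0 mulr_ge0 ?pi_ge0.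
rewrite -RintegralZl//; last exact: cintegrable_normc iF.
apply: le_Rintegral => //.
- exact: cintegrable_normc iT.
- exact: RintegrableZ (cintegrable_normc iF).
- by move=> t _; have [_ mK] := bm; rewrite normcM ler_wpM2r ?normc_ge0.
Qed.

Lemma mult_transform_linear (a : R[i]) f g h : MLspace c0 f -> MLspace c0 g ->
  eqRp h (fun x => a * f x + g x) -> eqRp (T h) (fun x => a * T f x + T g x).
Proof.
move=> hf hg hE x x0.
have [iF fF] := mstarP hf; have [iG gG] := mstarP hg.
have hH : mellin_rep c0 h (fun s => a * mstar c0 f s + mstar c0 g s).
  split; first by apply: cintegrableD => //; exact: cintegrableZ.
  by move=> y y0; rewrite hE// inv_mellinZD// fF// gG.
rewrite (mult_transformE x hH) -inv_mellinZD.
- rewrite (@inv_mellin_ext _ _ _ 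
    (fun s => a * (m s * mstar c0 f s) + m s * mstar c0 g s))//.
  by move=> t; rewrite mulrDr mulrCA.
- exact: L1_lineM bm iF.
- exact: L1_lineM bm iG.
Qed.

End OneMultiplier.

Section InversePair.
Variables (m m' : R[i] -> R[i]) (K K' : R).
Hypotheses (bm : bounded_mult c0 K m) (bm' : bounded_mult c0 K' m').
Hypothesis mm' : forall t, m' (c0 +i* t) * m (c0 +i* t) = 1.
Notation T := (mult_transform c0 m).
Notation S := (mult_transform c0 m').

Lemma mult_transformK f : MLspace c0 f -> eqRp (S (T f)) f.
Proof.
move=> hf x x0; rewrite (mult_transformE bm' x (mult_transform_rep bm hf)).
rewrite -[RHS](inv_mellin_mstar hf x0).
rewrite (@inv_mellin_ext _ _ _ (fun s => 1 * mstar c0 f s))// => t.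
by rewrite mulrA mm'.
Qed.

(** [f] is the image of [T f] under the multiplier [m'], bounded by [K']. *)
Lemma mult_transform_norm_inv f :
  MLspace c0 f -> MLnorm c0 f <= K' * MLnorm c0 (T f).
Proof.
move=> hf; have hT := mult_transform_space bm hf.
have hS := mult_transform_rep bm' hT.
rewrite (MLnorm_rep (mellin_rep_eq (mult_transformK hf) hS)) -(MLnorm_rep hS).
exact: mult_transform_norm.
Qed.

End InversePair.

Lemma mult_transform_automorphism m m' K K' :
  bounded_mult c0 K m -> bounded_mult c0 K' m' ->
  (forall t, m' (c0 +i* t) * m (c0 +i* t) = 1) ->
  MLautomorphism c0 (mult_transform c0 m).
Proof.
move=> bm bm' mm'.
have m'm t : m (c0 +i* t) * m' (c0 +i* t) = 1 by rewrite mulrC.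
split.
- by move=> f; exact: (mult_transform_space bm).
- by move=> a f g h; exact: (mult_transform_linear bm).
- move=> f g hf hg TT x x0.
  rewrite -(mult_transformK bm bm' mm' hf x0) -(mult_transformK bm bm' mm' hg x0).
  exact: (mult_transform_eq bm' (mult_transform_space bm hf) TT).
- move=> g hg; exists (mult_transform c0 m' g).
    exact: (mult_transform_space bm' hg).
  exact: (mult_transformK bm' bm m'm hg).
exists (K + K') => f hf; split.
  apply: le_trans (mult_transform_norm bm hf) _.
  by rewrite ler_wpM2r ?MLnorm_ge0// lerDl (bounded_mult_ge0 bm').
apply: le_trans (mult_transform_norm_inv bm bm' mm' hf) _.
by rewrite ler_wpM2r ?MLnorm_ge0// lerDr (bounded_mult_ge0 bm).
Qed.

Lemma mult_transform_reciprocal m m' K K' :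
  bounded_mult c0 K m -> bounded_mult c0 K' m' ->
  (forall t, m' (c0 +i* t) * m (c0 +i* t) = 1) ->
  MLreciprocal c0 (mult_transform c0 m) (mult_transform c0 m').
Proof.
move=> bm bm' mm'.
have m'm t : m (c0 +i* t) * m' (c0 +i* t) = 1 by rewrite mulrC.
split=> [f|g]; first exact: (mult_transformK bm bm' mm').
exact: (mult_transformK bm' bm m'm).
Qed.

End MultiplierTransform.

(** * The five expansions *)

Section Expansions.
Variables (R : realType) (c0 : R).
Hypothesis hc0 : 1 < c0.
Variables (f : R -> R[i]) (x : R).
Hypotheses (hf : MLspace c0 f) (x0 : 0 < x).
Notation eta := (fun s : R[i] => (1 - cpow (2 : R) (1 - s)) * zeta s).
Notation mu := (fun n : nat => (mobius n)%:~R : R[i]).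
Notation zpow n := (fun s : R[i] => cpow (n%:R : R) (- s)).
Notation ratio := (fun s : R[i] => cpow (2 : R) (1 - s)).

(** Every sum below is [M m] for an explicit multiplier [m], so that each
    expansion reduces to an identity between multipliers on the line. *)
Let M (m : R[i] -> R[i]) : R[i] := mult_transform c0 m f x.

Let iF : L1_line c0 (mstar c0 f). Proof. by have [] := mstarP hf. Qed.

Let M_ext m p : (forall t, m (c0 +i* t) = p (c0 +i* t)) -> M m = M p.
Proof.
move=> mp; rewrite /M /mult_transform.
by rewrite (inv_mellin_ext (G := fun s => p s * mstar c0 f s))// => t; rewrite mp.
Qed.

Let M1 m : (forall t, m (c0 +i* t) = 1) -> M m = f x.
Proof. by move=> m1; rewrite (M_ext (p := fun=> 1))//; exact: inv_mellin_mstar. Qed.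

Let MZ a m K : bounded_mult c0 K m -> a * M m = M (fun s => a * m s).
Proof.
move=> bm; rewrite /M /mult_transform -inv_mellinZ; last exact: L1_lineM bm iF.
apply/esym.
by rewrite (inv_mellin_ext (G := fun s => a * (m s * mstar c0 f s)))// => t; rewrite mulrA.
Qed.

Let M_dilate y : 0 < y -> f (x * y) = M (fun s => cpow y (- s)).
Proof.
move=> y0; have [_ fF] := mstarP hf.
have xy0 : 0 < x * y by exact: mulr_gt0.
by rewrite (fF _ xy0) (inv_mellin_scale c0 _ x0 y0).
Qed.

Let M_dilateM n m : (0 < n)%N -> (0 < m)%N ->
  f (x * n%:R * m%:R) = M (fun s => zpow n s * zpow m s).
Proof.
move=> n0 m0; have nm0 : (0 : R) < n%:R * m%:R by rewrite -natrM ltr0n muln_gt0 n0.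
rewrite -mulrA (M_dilate nm0).
by apply: M_ext => t; rewrite cpowM ?ltr0n.
Qed.

Let M_dilate2 n k : (0 < n)%N ->
  f (x * n%:R * 2 ^+ k) = M (fun s => zpow n s * cpow 2 (- s) ^+ k).
Proof.
move=> n0; have n0' : (0 : R) < n%:R by rewrite ltr0n.
have k0 : (0 : R) < 2 ^+ k by rewrite exprn_gt0.
rewrite -mulrA (M_dilate (mulr_gt0 n0' k0)).
by apply: M_ext => t; rewrite (cpowM _ n0' k0) cpowX.
Qed.

Let M_dilateM2 n m k : (0 < n)%N -> (0 < m)%N ->
  f (x * n%:R * m%:R * 2 ^+ k) =
  M (fun s => zpow n s * zpow m s * cpow 2 (- s) ^+ k).
Proof.
move=> n0 m0; have nm0 : (0 < n * m)%N by rewrite muln_gt0 n0.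
rewrite -(mulrA x) -natrM (M_dilate2 _ nm0).
by apply: M_ext => t; rewrite natrM cpowM ?ltr0n.
Qed.

Let M_series a p P (u : nat -> R[i]) : mult_series c0 a p P ->
  (forall n, (a <= n)%N -> u n = M (p n)) -> csum_to a u (M P).
Proof. by move=> h uE; exact: (mult_series_mellin h iF uE). Qed.

Let ratioX s k : ratio s ^+ k = 2 ^+ k * cpow 2 (- s) ^+ k.
Proof. by rewrite /= cpow2_1B exprMn. Qed.

Let bzpow n := bounded_mult_cpow c0 (n%:R : R).
Let bpow2 k := bounded_multX k (bounded_mult_cpow c0 (2 : R)).
Let bratio k := bounded_multX k (bounded_mult_ratio c0).
Let ms_zeta := zeta_mult_series hc0.
Let ms_mu := mobius_mult_series hc0.
Let ms_eta := eta_mult_series hc0.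
Let ms_ratio := ratio_mult_series hc0.
Let bz := zeta_bounded hc0.
Let bzV := zetaV_bounded hc0.
Let be := eta_bounded hc0.
Let brV := ratioV_bounded hc0.

Lemma dilation_sum : csum_to 1 (fun n => f (x * n%:R)) (mult_transform c0 (@zeta R) f x).
Proof. by apply: (M_series ms_zeta) => n n0; rewrite M_dilate ?ltr0n. Qed.

Lemma dilation_mobius_sum : csum_to 1 (fun n => mu n * f (x * n%:R))
  (mult_transform c0 (fun s => (zeta s)^-1) f x).
Proof. by apply: (M_series ms_mu) => n n0; rewrite M_dilate ?ltr0n// (MZ _ (bzpow n)). Qed.

Lemma dilation_alt_sum : csum_to 1 (fun n => (-1) ^+ n.-1 * f (x * n%:R))
  (mult_transform c0 eta f x).
Proof. by apply: (M_series ms_eta) => n n0; rewrite M_dilate ?ltr0n// (MZ _ (bzpow n)). Qed.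

Let inner_dyadic k : csum_to 1 (fun n => 2 ^+ k * mu n * f (x * n%:R * 2 ^+ k))
  (M (fun s => ratio s ^+ k * (zeta s)^-1)).
Proof.
apply: (M_series (mult_seriesM (bratio k) ms_mu)) => n n0.
rewrite M_dilate2// (MZ _ (bounded_multM (bzpow n) (bpow2 k))).
by apply: M_ext => t; rewrite ratioX; ring.
Qed.

Lemma dilation_dyadic_sum :
  (forall k, csummable 1 (fun n => 2 ^+ k * mu n * f (x * n%:R * 2 ^+ k))) /\
  csum_to 0 (fun k => csum 1 (fun n => 2 ^+ k * mu n * f (x * n%:R * 2 ^+ k)))
    (mult_transform c0 (fun s => (eta s)^-1) f x).
Proof.
split; first by move=> k; eexists; exact: inner_dyadic.
rewrite -/(M _) (M_ext (p := fun s => (zeta s)^-1 * (1 - ratio s)^-1)); last first.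
  by move=> t; rewrite invfM mulrC.
apply: (M_series (mult_seriesM bzV ms_ratio)) => k _.
by rewrite (csum_toE (@inner_dyadic k)); apply: M_ext => t; rewrite mulrC.
Qed.

Let inner_zeta n : (0 < n)%N ->
  csum_to 1 (fun m => f (x * n%:R * m%:R)) (M (fun s => zpow n s * zeta s)).
Proof.
by move=> n0; apply: (M_series (mult_seriesM (bzpow n) ms_zeta)) => m m0; exact: M_dilateM.
Qed.

Lemma expansion_mobius_zeta :
  (forall n, (0 < n)%N -> csummable 1 (fun m => f (x * n%:R * m%:R))) /\
  csum_to 1 (fun n => mu n * csum 1 (fun m => f (x * n%:R * m%:R))) (f x).
Proof.
split; first by move=> n n0; eexists; exact: inner_zeta.
rewrite -(M1 (m := fun s => zeta s * (zeta s)^-1)); last first.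
  by move=> t; rewrite divff// zeta_line_neq0.
apply: (M_series (mult_seriesM bz ms_mu)) => n n0.
rewrite (csum_toE (@inner_zeta n n0)) (MZ _ (bounded_multM (bzpow n) bz)).
by apply: M_ext => t; ring.
Qed.

Let inner_mobius n : (0 < n)%N ->
  csum_to 1 (fun m => mu m * f (x * n%:R * m%:R)) (M (fun s => zpow n s * (zeta s)^-1)).
Proof.
move=> n0; apply: (M_series (mult_seriesM (bzpow n) ms_mu)) => m m0.
rewrite M_dilateM// (MZ _ (bounded_multM (bzpow n) (bzpow m))).
by apply: M_ext => t; ring.
Qed.

Lemma expansion_zeta_mobius :
  (forall n, (0 < n)%N -> csummable 1 (fun m => mu m * f (x * n%:R * m%:R))) /\
  csum_to 1 (fun n => csum 1 (fun m => mu m * f (x * n%:R * m%:R))) (f x).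
Proof.
split; first by move=> n n0; eexists; exact: inner_mobius.
rewrite -(M1 (m := fun s => (zeta s)^-1 * zeta s)); last first.
  by move=> t; rewrite mulVf// zeta_line_neq0.
apply: (M_series (mult_seriesM bzV ms_zeta)) => n n0.
by rewrite (csum_toE (@inner_mobius n n0)); apply: M_ext => t; rewrite mulrC.
Qed.

Let inner_alt2 k n : (0 < n)%N ->
  csum_to 1 (fun m => (-1) ^+ m.-1 * f (x * n%:R * m%:R * 2 ^+ k))
    (M (fun s => (zpow n s * cpow 2 (- s) ^+ k) * eta s)).
Proof.
move=> n0; apply: (M_series (mult_seriesM (bounded_multM (bzpow n) (bpow2 k)) ms_eta)) => m m0.
rewrite M_dilateM2// (MZ _ (bounded_multM (bounded_multM (bzpow n) (bzpow m)) (bpow2 k))).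
by apply: M_ext => t; ring.
Qed.

Let middle_alt k : csum_to 1 (fun n => 2 ^+ k * mu n *
    csum 1 (fun m => (-1) ^+ m.-1 * f (x * n%:R * m%:R * 2 ^+ k)))
  (M (fun s => (ratio s ^+ k * eta s) * (zeta s)^-1)).
Proof.
apply: (M_series (mult_seriesM (bounded_multM (bratio k) be) ms_mu)) => n n0.
rewrite (csum_toE (@inner_alt2 k n n0)).
rewrite (MZ _ (bounded_multM (bounded_multM (bzpow n) (bpow2 k)) be)).
by apply: M_ext => t; rewrite ratioX; ring.
Qed.

(** The sums over [m] and [n] leave the multiplier [eta / zeta = 1 - ratio] times
    [ratio ^+ k], and the geometric series in [k] removes it. *)
Lemma expansion_ratio_mobius_alt :
  [/\ (forall k n, (0 < n)%N ->
        csummable 1 (fun m => (-1) ^+ m.-1 * f (x * n%:R * m%:R * 2 ^+ k))),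
      (forall k, csummable 1 (fun n => 2 ^+ k * mu n *
         csum 1 (fun m => (-1) ^+ m.-1 * f (x * n%:R * m%:R * 2 ^+ k))))
    & csum_to 0 (fun k => csum 1 (fun n => 2 ^+ k * mu n *
        csum 1 (fun m => (-1) ^+ m.-1 * f (x * n%:R * m%:R * 2 ^+ k)))) (f x)].
Proof.
split; first by move=> k n n0; eexists; exact: inner_alt2.
  by move=> k; eexists; exact: middle_alt.
rewrite -(M1 (m := fun s => (eta s * (zeta s)^-1) * (1 - ratio s)^-1)); last first.
  by move=> t; rewrite mulfK ?zeta_line_neq0// divff// ratio_line_neq1.
apply: (M_series (mult_seriesM (bounded_multM be bzV) ms_ratio)) => k _.
by rewrite (csum_toE (@middle_alt k)); apply: M_ext => t; ring.
Qed.

Let inner_mobius2 n k : (0 < n)%N ->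
  csum_to 1 (fun m => 2 ^+ k * mu m * f (x * n%:R * m%:R * 2 ^+ k))
    (M (fun s => (zpow n s * ratio s ^+ k) * (zeta s)^-1)).
Proof.
move=> n0; apply: (M_series (mult_seriesM (bounded_multM (bzpow n) (bratio k)) ms_mu)) => m m0.
rewrite M_dilateM2// (MZ _ (bounded_multM (bounded_multM (bzpow n) (bzpow m)) (bpow2 k))).
by apply: M_ext => t; rewrite ratioX; ring.
Qed.

Let middle_mobius n : (0 < n)%N ->
  csum_to 0 (fun k => csum 1 (fun m => 2 ^+ k * mu m * f (x * n%:R * m%:R * 2 ^+ k)))
    (M (fun s => (zpow n s * (zeta s)^-1) * (1 - ratio s)^-1)).
Proof.
move=> n0; apply: (M_series (mult_seriesM (bounded_multM (bzpow n) bzV) ms_ratio)) => k _.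
by rewrite (csum_toE (@inner_mobius2 n k n0)); apply: M_ext => t; ring.
Qed.

Lemma expansion_alt_ratio_mobius :
  [/\ (forall n k, (0 < n)%N ->
        csummable 1 (fun m => 2 ^+ k * mu m * f (x * n%:R * m%:R * 2 ^+ k))),
      (forall n, (0 < n)%N -> csummable 0 (fun k => csum 1
         (fun m => 2 ^+ k * mu m * f (x * n%:R * m%:R * 2 ^+ k))))
    & csum_to 1 (fun n => (-1) ^+ n.-1 * csum 0 (fun k => csum 1
        (fun m => 2 ^+ k * mu m * f (x * n%:R * m%:R * 2 ^+ k)))) (f x)].
Proof.
split; first by move=> n k n0; eexists; exact: inner_mobius2.
  by move=> n n0; eexists; exact: middle_mobius.
rewrite -(M1 (m := fun s => ((zeta s)^-1 * (1 - ratio s)^-1) * eta s)); last first.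
  by move=> t; rewrite -invfM [zeta _ * _]mulrC mulVf// eta_line_neq0.
apply: (M_series (mult_seriesM (bounded_multM bzV brV) ms_eta)) => n n0.
rewrite (csum_toE (@middle_mobius n n0)).
rewrite (MZ _ (bounded_multM (bounded_multM (bzpow n) bzV) brV)).
by apply: M_ext => t; ring.
Qed.

Let inner_alt n : (0 < n)%N ->
  csum_to 1 (fun m => (-1) ^+ m.-1 * f (x * n%:R * m%:R)) (M (fun s => zpow n s * eta s)).
Proof.
move=> n0; apply: (M_series (mult_seriesM (bzpow n) ms_eta)) => m m0.
rewrite M_dilateM// (MZ _ (bounded_multM (bzpow n) (bzpow m))).
by apply: M_ext => t; ring.
Qed.

Lemma expansion_mobius_alt :
  (forall n, (0 < n)%N -> csummable 1 (fun m => (-1) ^+ m.-1 * f (x * n%:R * m%:R))) /\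
  csum_to 1 (fun n => mu n * csum 1 (fun m => (-1) ^+ m.-1 * f (x * n%:R * m%:R)))
    (f x - 2 * f (2 * x)).
Proof.
split; first by move=> n n0; eexists; exact: inner_alt.
have b2 := bounded_mult_cpow c0 (2 : R).
have -> : f x - 2 * f (2 * x) = M (fun s => eta s * (zeta s)^-1).
  rewrite (mulrC 2 x) M_dilate// addrC -mulNr -(M1 (m := fun=> 1))//.
  rewrite /M /mult_transform -inv_mellinZD; last 2 first.
  - exact: L1_lineM b2 iF.
  - exact: L1_lineM (bounded_mult_cst c0 1) iF.
  apply: (f_equal (fun g : R -> R[i] => g x)); apply: inv_mellin_ext => t.
  by rewrite mulfK ?zeta_line_neq0// cpow2_1B; ring.
apply: (M_series (mult_seriesM be ms_mu)) => n n0.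
rewrite (csum_toE (@inner_alt n n0)) (MZ _ (bounded_multM (bzpow n) be)).
by apply: M_ext => t; ring.
Qed.

End Expansions.

(** * The reciprocal pairs *)

Theorem theorem1 (R : realType) (c0 : R) (hc0 : 1 < c0) :
  let mu := fun n : nat => (mobius n)%:~R : R[i] in
  let eta := fun s : R[i] => (1 - cpow 2 (1 - s)) * zeta s in
  let T1 := mult_transform c0 (@zeta R) in
  let S1 := mult_transform c0 (fun s => (zeta s)^-1) in
  let T2 := mult_transform c0 eta in
  let S2 := mult_transform c0 (fun s => (eta s)^-1) in
  (* the expansions of f, (A) to (D) and the fifth one *)
  (forall f : R -> R[i], MLspace c0 f -> forall x : R, 0 < x ->
    [/\ (* (A) *)
        (forall n, (0 < n)%N ->
           csummable 1 (fun m => f (x * n%:R * m%:R))) /\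
        csum_to 1 (fun n => mu n * csum 1 (fun m => f (x * n%:R * m%:R))) (f x),
        (* (B) *)
        (forall n, (0 < n)%N ->
           csummable 1 (fun m => mu m * f (x * n%:R * m%:R))) /\
        csum_to 1 (fun n => csum 1 (fun m => mu m * f (x * n%:R * m%:R))) (f x),
        (* (C) *)
        [/\ (forall k n, (0 < n)%N ->
              csummable 1
                (fun m => (-1) ^+ m.-1 * f (x * n%:R * m%:R * 2 ^+ k))),
            (forall k, csummable 1
              (fun n => 2 ^+ k * mu n *
                 csum 1 (fun m => (-1) ^+ m.-1 * f (x * n%:R * m%:R * 2 ^+ k))))
          & csum_to 0 (fun k => csum 1 (fun n => 2 ^+ k * mu n *
              csum 1 (fun m => (-1) ^+ m.-1 * f (x * n%:R * m%:R * 2 ^+ k))))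
              (f x)],
        (* (D) *)
        [/\ (forall n k, (0 < n)%N ->
              csummable 1
                (fun m => 2 ^+ k * mu m * f (x * n%:R * m%:R * 2 ^+ k))),
            (forall n, (0 < n)%N ->
              csummable 0 (fun k => csum 1
                (fun m => 2 ^+ k * mu m * f (x * n%:R * m%:R * 2 ^+ k))))
          & csum_to 1 (fun n => (-1) ^+ n.-1 * csum 0 (fun k => csum 1
              (fun m => 2 ^+ k * mu m * f (x * n%:R * m%:R * 2 ^+ k))))
              (f x)]
      & (forall n, (0 < n)%N ->
           csummable 1 (fun m => (-1) ^+ m.-1 * f (x * n%:R * m%:R))) /\
        csum_to 1 (fun n => mu n *
            csum 1 (fun m => (-1) ^+ m.-1 * f (x * n%:R * m%:R)))
          (f x - 2 * f (2 * x))]) /\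
  (* the reciprocal pair generated by (A), (B) *)
  [/\ (forall f, MLspace c0 f ->
         L1_line c0 (fun s => zeta s * mstar c0 f s) /\
         forall x : R, 0 < x -> csum_to 1 (fun n => f (x * n%:R)) (T1 f x)),
      (forall g, MLspace c0 g ->
         L1_line c0 (fun s => (zeta s)^-1 * mstar c0 g s) /\
         forall x : R, 0 < x -> csum_to 1 (fun n => mu n * g (x * n%:R)) (S1 g x)),
      MLreciprocal c0 T1 S1,
      MLautomorphism c0 T1 /\ MLautomorphism c0 S1
    & (forall f, MLspace c0 f ->
         (zeta c0%:C)^-1 * (MLnorm c0 (T1 f))%:C <= (MLnorm c0 f)%:C /\
         (MLnorm c0 f)%:C <= zeta c0%:C * (MLnorm c0 (T1 f))%:C)] /\
  (* the reciprocal pair generated by (C), (D) *)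
  [/\ (forall f, MLspace c0 f ->
         L1_line c0 (fun s => eta s * mstar c0 f s) /\
         forall x : R, 0 < x ->
           csum_to 1 (fun n => (-1) ^+ n.-1 * f (x * n%:R)) (T2 f x)),
      (forall g, MLspace c0 g ->
         L1_line c0 (fun s => (eta s)^-1 * mstar c0 g s) /\
         forall x : R, 0 < x ->
           (forall k, csummable 1
              (fun n => 2 ^+ k * mu n * g (x * n%:R * 2 ^+ k))) /\
           csum_to 0 (fun k => csum 1
              (fun n => 2 ^+ k * mu n * g (x * n%:R * 2 ^+ k))) (S2 g x)),
      MLreciprocal c0 T2 S2,
      MLautomorphism c0 T2 /\ MLautomorphism c0 S2
    & (forall f, MLspace c0 f ->
         (zeta c0%:C)^-1 * (MLnorm c0 (T2 f))%:C <= (MLnorm c0 f)%:C /\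
         (MLnorm c0 f)%:C <=
           (1 - cpow 2 (1 - c0%:C))^-1 * zeta c0%:C * (MLnorm c0 (T2 f))%:C)].
Proof.
move=> mu eta T1 S1 T2 S2.
have bz := zeta_bounded hc0; have bzV := zetaV_bounded hc0.
have be := eta_bounded hc0; have beV := etaV_bounded hc0.
have zz t : (zeta (c0 +i* t))^-1 * zeta (c0 +i* t) = 1.
  by rewrite mulVf// zeta_line_neq0.
have zz' t : zeta (c0 +i* t) * (zeta (c0 +i* t))^-1 = 1 by rewrite mulrC.
have ee t : (eta (c0 +i* t))^-1 * eta (c0 +i* t) = 1.
  by rewrite mulVf// eta_line_neq0.
have ee' t : eta (c0 +i* t) * (eta (c0 +i* t))^-1 = 1 by rewrite mulrC.
have L1 m K f : bounded_mult c0 K m -> MLspace c0 f ->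
    L1_line c0 (fun s => m s * mstar c0 f s).
  by move=> bm /mstarP[iF _]; exact: L1_lineM bm iF.
have z0 : 0 < zeta_real c0 by exact: zeta_real_gt0.
split; [|split].
- move=> f hf x x0; split.
  + exact: (expansion_mobius_zeta hc0 hf x0).
  + exact: (expansion_zeta_mobius hc0 hf x0).
  + exact: (expansion_ratio_mobius_alt hc0 hf x0).
  + exact: (expansion_alt_ratio_mobius hc0 hf x0).
  + exact: (expansion_mobius_alt hc0 hf x0).
- split.
  + move=> f hf; split; first exact: L1 bz hf.
    by move=> x x0; exact: (@dilation_sum R c0 hc0 f x hf x0).
  + move=> g hg; split; first exact: L1 bzV hg.
    by move=> x x0; exact: (@dilation_mobius_sum R c0 hc0 g x hg x0).
  + exact: (mult_transform_reciprocal bz bzV zz).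
  + split; first exact: (mult_transform_automorphism bz bzV zz).
    exact: (mult_transform_automorphism bzV bz zz').
  + move=> f hf; rewrite zeta_realE//; split.
      rewrite -fmorphV -rmorphM lecR ler_pdivrMl//.
      exact: (mult_transform_norm bz hf).
    rewrite -rmorphM lecR; exact: (mult_transform_norm_inv bz bzV zz hf).
- split.
  + move=> f hf; split; first exact: L1 be hf.
    by move=> x x0; exact: (@dilation_alt_sum R c0 hc0 f x hf x0).
  + move=> g hg; split; first exact: L1 beV hg.
    by move=> x x0; exact: (@dilation_dyadic_sum R c0 hc0 g x hg x0).
  + exact: (mult_transform_reciprocal be beV ee).
  + split; first exact: (mult_transform_automorphism be beV ee).
    exact: (mult_transform_automorphism beV be ee').
  + move=> f hf; rewrite zeta_realE// ratio_realE; split.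
      rewrite -fmorphV -rmorphM lecR ler_pdivrMl//.
      exact: (mult_transform_norm be hf).
    rewrite -!rmorphM lecR; exact: (mult_transform_norm_inv be beV ee hf).
Qed.
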